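(* Fix an odd integer $k\geq 3$. There exists a generic class $G$ in the space $M_{2,k}$ of binary forms of degree $k$ with real coefficients such that the following holds for every polynomial $P\in \mathbb{R}[X_1,X_2]$ of degree $k$ whose leading form (homogeneous part of degree $k$) $P_k$ belongs to $G$ and every $s\in\mathbb{R}$: if there exists a constant $C_s$ such that \[ \Big\|\sup_{0<t<1}|T_t^Pf|\Big\|_{L^1(B_2(0,1))} \leq C_s \|f\|_{H^s(\mathbb{R}^2)}\qquad \text{for all } f\in H^s(\mathbb{R}^2), \] then $s\geq 1/3$.
   Context: $M_{n,k}$ denotes the (moduli) space of homogeneous polynomials of degree $k$ in $n$ variables with real coefficients, identified with the affine space of their coefficients (so $M_{2,k}$ is identified with $\mathbb{R}^{k+1}$ via $\sum_{i=0}^k c_iX_1^iX_2^{k-i}\leftrightarrow(c_0,\dots,c_k)$). A class of forms in $M_{n,k}$ is generic if it is dense in $M_{n,k}$ with respect to the Zariski topology. The Fourier transform is $\hat f(\xi)=\int_{\mathbb{R}^2} f(x)e^{-ix\cdot\xi}\,dx$. For a real polynomial $P$ in two variables, define \[ T_t^{P}f(x) = \frac{1}{(2\pi)^2} \int_{\mathbb{R}^2} \hat{f}(\xi) e^{i(x\cdot \xi + P(\xi)t)}\,d\xi , \] initially for $f$ of Schwartz class on $\mathbb{R}^2$ (and extended to $H^s$ as the Fourier multiplier $e^{iP(\xi)t}$). The Sobolev space $H^s(\mathbb{R}^2)$ consists of all tempered distributions $f$ with finite norm given by $\|f\|_{H^s(\mathbb{R}^2)}^2=(2\pi)^{-2}\int_{\mathbb{R}^2}(1+|\xi|^2)^s|\hat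 f(\xi)|^2\,d\xi$. $B_2(0,1)$ is the unit ball in $\mathbb{R}^2$ centered at the origin. *)

(* Defs.v *)
From HB Require Import structures.
From mathcomp Require Import all_boot all_order all_algebra.
From mathcomp Require Import complex.
From mathcomp.multinomials Require mpoly.
(* The notations of mpoly cannot be loaded together with those of analysis. *)
Import -(notations) mpoly.
From mathcomp Require Import all_classical all_reals all_analysis measurable_realfun.

Set Implicit Arguments.
Unset Strict Implicit.
Unset Printing Implicit Defensive.

Import Order.TTheory GRing.Theory Num.Theory.
Import numFieldNormedType.Exports.

Local Open Scope classical_set_scope.
Local Open Scope ring_scope.

(** * Binary forms and the Zariski topology on their coefficients *)

Definition binary_form (R : realType) (k : nat) (c : 'I_k.+1 -> R)
    : mpoly.mpoly 2 R :=
  \sum_(i < k.+1)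
    c i *: (mpolyX R (mnm1 (ord0 : 'I_2)) ^+ i
            * mpolyX R (mnm1 (ord_max : 'I_2)) ^+ (k - i)).

Definition zero_locus (R : realType) (n : nat) (F : set (mpoly.mpoly n R))
    : set ('I_n -> R) :=
  [set c | forall p, F p -> meval c p = 0].

Definition zariski_closed (R : realType) (n : nat) (A : set ('I_n -> R)) : Prop :=
  exists F : set (mpoly.mpoly n R), A = zero_locus F.

Definition zariski_dense (R : realType) (n : nat) (G : set ('I_n -> R)) : Prop :=
  forall A : set ('I_n -> R), zariski_closed A -> G `<=` A -> A = setT.

Definition eval2 (R : realType) (P : mpoly.mpoly 2 R) (xi : R * R) : R :=
  meval (fun i : 'I_2 => if i == ord0 then xi.1 else xi.2) P.

(** * The Euclidean plane and complex-valued functions on it *)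

(* The library norm on [R * R] is the sup norm, so the Euclidean one is
   written out. *)
Definition dot (R : realType) (x y : R * R) : R := x.1 * y.1 + x.2 * y.2.

Definition sqnorm (R : realType) (x : R * R) : R := dot x x.

Definition unit_ball (R : realType) : set (R * R) := [set x | sqnorm x < 1].

Arguments unit_ball : clear implicits.

Notation leb2 R := (@lebesgue_measure R \x @lebesgue_measure R)%E (only parsing).

(* The measurable structure carried by [leb2 R]. *)
Notation plane R := (measurableTypeR R * measurableTypeR R)%type (only parsing).

Definition cmod (R : realType) (z : R[i]) : R := ComplexField.Normc.normc z.

Definition cexpi (R : realType) (theta : R) : R[i] :=
  (cos theta +i* sin theta)%C.

Definition cmeasurable (R : realType) (D : set (R * R)) (f : R * R -> R[i]) :=
  measurable_fun (D : set (plane R)) (fun x => complex.Re (f x)) /\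
  measurable_fun (D : set (plane R)) (fun x => complex.Im (f x)).

Definition cintegrable (R : realType) (D : set (R * R)) (f : R * R -> R[i]) :=
  (leb2 R).-integrable D (fun x => (complex.Re (f x))%:E) /\
  (leb2 R).-integrable D (fun x => (complex.Im (f x))%:E).

Definition cintegral (R : realType) (D : set (R * R)) (f : R * R -> R[i])
    : R[i] :=
  ((\int[leb2 R]_(x in D) complex.Re (f x))
     +i* (\int[leb2 R]_(x in D) complex.Im (f x)))%C.

(** * Schwartz functions and tempered distributions *)

Definition partial (R : realType) (a b : nat) (h : R * R -> R) : R * R -> R :=
  iter a (fun g x => 'D_((1, 0) : R * R) g x)
    (iter b (fun g x => 'D_((0, 1) : R * R) g x) h).

Definition smooth (R : realType) (h : R * R -> R) : Prop :=
  forall (a b : nat) (x : R * R), differentiable (partial a b h) x.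

(* The N-th Schwartz seminorm of [h] is at most [M]. *)
Definition seminorm_le (R : realType) (N : nat) (M : R) (h : R * R -> R) : Prop :=
  forall (a b : nat) (x : R * R), (a + b <= N)%N ->
    (1 + sqnorm x) ^+ N * `|partial a b h x| <= M.

Definition schwartz (R : realType) (phi : R * R -> R[i]) : Prop :=
  let re x := complex.Re (phi x) in
  let im x := complex.Im (phi x) in
  [/\ smooth re, smooth im &
      forall N, exists M, seminorm_le N M re /\ seminorm_le N M im].

(* Only the values at Schwartz functions are meaningful. *)
Definition distribution (R : realType) := (R * R -> R[i]) -> R[i].

Definition tempered (R : realType) (f : distribution R) : Prop :=
  (forall (a : R[i]) (phi psi : R * R -> R[i]), schwartz phi -> schwartz psi ->
     f (fun x => a * phi x + psi x) = a * f phi + f psi) /\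
  (exists (C : R) (N : nat), forall (phi : R * R -> R[i]) (M : R),
     schwartz phi ->
     seminorm_le N M (fun x => complex.Re (phi x)) ->
     seminorm_le N M (fun x => complex.Im (phi x)) ->
     cmod (f phi) <= C * M).

Definition dist_of (R : realType) (g : R * R -> R[i]) : distribution R :=
  fun phi => cintegral setT (fun x => g x * phi x).

Definition fourier (R : realType) (phi : R * R -> R[i]) (xi : R * R) : R[i] :=
  cintegral setT (fun x => phi x * cexpi (- dot x xi)).

Definition inv_fourier (R : realType) (phi : R * R -> R[i]) (x : R * R) : R[i] :=
  real_complex R ((2 * pi) ^- 2)
    * cintegral setT (fun xi => phi xi * cexpi (dot x xi)).

(* On tempered distributions both transforms act by duality. *)
Definition dist_fourier (R : realType) (f : distribution R) : distribution R :=
  fun phi => f (fourier phi).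

Definition dist_inv_fourier (R : realType) (f : distribution R)
    : distribution R :=
  fun phi => f (inv_fourier phi).

(** * Sobolev spaces *)

Definition fourier_transform_is (R : realType) (f : distribution R)
    (fhat : R * R -> R[i]) : Prop :=
  cmeasurable setT fhat /\
  forall phi, schwartz phi ->
    cintegrable setT (fun xi => fhat xi * phi xi) /\
    dist_fourier f phi = dist_of fhat phi.

(* The H^s norm of the distribution with Fourier transform [fhat]. *)
Definition sobolev_norm (R : realType) (s : R) (fhat : R * R -> R[i]) : \bar R :=
  ((((2 * pi) ^- 2)%:E
    * \int[leb2 R]_xi ((1 + sqnorm xi) `^ s * cmod (fhat xi) ^+ 2)%:E)
   `^ (2^-1)%R)%E.

(* [f] belongs to H^s and [fhat] is (a representative of) its Fourier
   transform. *)
Definition in_sobolev (R : realType) (s : R) (f : distribution R)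
    (fhat : R * R -> R[i]) : Prop :=
  [/\ tempered f, fourier_transform_is f fhat & (sobolev_norm s fhat < +oo)%E].

(** * The propagator and its maximal function *)

(* T_t^P f, the Fourier multiplier exp(i t P) applied to the distribution with
   Fourier transform [fhat].  For f of Schwartz class this is, by Fubini, the
   distribution given by the function
     x |-> (2 pi)^-2 \int fhat(xi) exp(i (x . xi + P(xi) t)) dxi. *)
Definition propagator (R : realType) (P : mpoly.mpoly 2 R) (t : R)
    (fhat : R * R -> R[i]) : distribution R :=
  dist_inv_fourier (dist_of (fun xi => cexpi (eval2 P xi * t) * fhat xi)).

(* On the unit ball, the distribution [f] is the integrable function [u]. *)
Definition represented_by (R : realType) (f : distribution R)
    (u : R * R -> R[i]) : Prop :=
  cintegrable (unit_ball R) u /\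
  forall psi, schwartz psi ->
    (exists2 r : R, r < 1 & forall x, r <= sqnorm x -> psi x = 0) ->
    f psi = cintegral (unit_ball R) (fun x => u x * psi x).

Definition sup_time (R : realType) (u : R -> R * R -> R[i]) (x : R * R)
    : \bar R :=
  ereal_sup [set (cmod (u t x))%:E | t in `]0%R, 1%R[].

(* For f in H^s each T_t^P f is defined only up to a null set depending on t,
   and the supremum runs over uncountably many t.  As usual, the bound is
   required of suitable representatives [u t].  This loses nothing: if
   (t, x) |-> T_t^P f(x) is continuous, e.g. for f of Schwartz class, then its
   supremum is that over rational t, so that it is a.e. at most the supremum
   of any other choice of representatives. *)
Definition maximal_estimate (R : realType) (P : mpoly.mpoly 2 R) (s C : R)
    : Prop :=
  forall (f : distribution R) (fhat : R * R -> R[i]), in_sobolev s f fhat ->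
    exists u : R -> R * R -> R[i],
      [/\ forall t, 0 < t < 1 -> represented_by (propagator P t fhat) (u t),
          measurable_fun (unit_ball R : set (plane R)) (sup_time u) &
          (\int[leb2 R]_(x in unit_ball R) sup_time u x
             <= C%:E * sobolev_norm s fhat)%E].

(** * Degrees and leading forms *)

(* [mmeasure mdeg P] is the total degree of [P] plus one. *)
Definition has_degree (R : realType) (P : mpoly.mpoly 2 R) (k : nat) : Prop :=
  mmeasure mdeg P = k.+1.

Definition leading_form_in (R : realType) (k : nat) (P : mpoly.mpoly 2 R)
    (G : set ('I_k.+1 -> R)) : Prop :=
  exists2 c, G c & pihomog mdeg k P = binary_form c.

(* Main.v *)
(* Since k is odd, for generic P_k the polynomial P_k(1, m) has an
   inflection point m at which its slope does not vanish.  Near the frequency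
   (N, N m) the symbol P is then linear in the second variable up to errors that
   stay bounded for times of order N^(1-k) and frequency shifts of order N^(2/3),
   because the second-order term is missing.  Hence a datum whose Fourier
   transform is a nonnegative bump on a box of size 1 x N^(2/3) around (N, N m) is
   concentrated in a horizontal strip of width N^(-2/3), and this strip travels
   through the unit ball without dispersing.  Its L^2 norm is N^(-1/3) times the
   size of its maximal function, and its H^s norm is N^s times larger, so that
   s >= 1/3.  The datum is a product of two modulated Fejer kernels
   (1 - cos (a x)) / x^2, whose Fourier transforms are tents, and the propagated
   distributions are bounded from below by testing them against wave packets
   localised in the moving strip. *)

Require Import Defs.
From HB Require Import structures.
From mathcomp Require Import all_boot all_order all_algebra.
From mathcomp Require Import complex polyrcf.
From mathcomp.multinomials Require mpoly.
Import -(notations) mpoly.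
From mathcomp Require Import all_classical all_reals all_analysis measurable_realfun.
From mathcomp Require Import ring lra zify.
Set Implicit Arguments.
Unset Strict Implicit.
Unset Printing Implicit Defensive.
Import Order.TTheory GRing.Theory Num.Theory.
Import numFieldNormedType.Exports.
Local Open Scope classical_set_scope.
Local Open Scope ring_scope.

(** * Inflection points of binary forms *)

(** The exponent 2/3 balances the cubic error: a shift d of the second frequency costs N^k (d/N)^3
    over a time N^(1-k), that is d^3/N^2, and this stays bounded up to d of order N^(2/3). With N =
    n^3 the exponents of n become integers and the strips can be counted: n^2 of them, each of width
    of order n^(-2). The obstacle is that the estimate only provides representatives [u t], each
    tied to its own distribution, so that pointwise lower bounds for the propagated datum are not at
    hand. They are replaced by n^2 pairings, one at each of n^2 times, with test functions whose
    moduli sum to at most 1; the sum of the pairings then bounds the integral of the supremum from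
    below. This sum is of order n^4, against a Sobolev norm of order n^(3 + 3 sigma) with sigma =
    max(s, 0), whence the threshold 1/3. Fejer kernels serve as data because their transforms are
    elementary and compactly supported: the frequency box is exact, and the pairings become
    integrals of nonnegative functions against a nearly constant phase. *)

Section zariski.
Variable R : realType.

(** Multiplication by X - a repairs the single exceptional point; the product then has all natural
    numbers as roots. *)
Lemma poly_eq0_of_horner (Q : {poly R}) (a : R) :
  (forall t, t != a -> Q.[t] = 0) -> Q = 0.
Proof.
move=> Q0; suff : Q * ('X - a%:P) = 0.
  by move/eqP; rewrite mulf_eq0 polyXsubC_eq0 orbF => /eqP.
apply: (@roots_geq_poly_eq0 _ _ (mkseq (fun i => i%:R) (size (Q * ('X - a%:P))))).
- apply/allP => x _; rewrite rootE hornerM hornerXsubC.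
  have [->|xa] := eqVneq x a; first by rewrite subrr mulr0.
  by rewrite Q0// mul0r.
- by rewrite mkseq_uniq// => i j /eqP; rewrite eqr_nat => /eqP.
- by rewrite size_mkseq.
Qed.

Lemma meval_line (n : nat) (p : mpoly.mpoly n R) (c d : 'I_n -> R) :
  exists Q : {poly R}, forall t, Q.[t] = meval (fun i => c i + t * d i) p.
Proof.
exists (\sum_(m <- msupp p) mcoeff m p *:
  \prod_i ((c i)%:P + d i *: 'X) ^+ (m i)) => t.
rewrite mevalE horner_sum; apply: eq_bigr => m _.
rewrite hornerZ horner_prod; congr (_ * _); apply: eq_bigr => i _.
by rewrite horner_exp hornerD hornerC hornerZ hornerX mulrC.
Qed.

(* The polynomial P_k(1, X), where P_k is the form with coefficients [c]. *)
Definition slice (k : nat) (c : 'I_k.+1 -> R) : {poly R} :=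
  \sum_(i < k.+1) c i *: 'X^(k - i).

Definition inflected (k : nat) : set ('I_k.+1 -> R) :=
  [set c | exists2 m, (slice c)^`(2).[m] = 0 & (slice c)^`().[m] != 0].

Lemma slice_line (k : nat) (c d : 'I_k.+1 -> R) t :
  slice (fun i => c i + t * d i) = slice c + t *: slice d.
Proof.
rewrite /slice scaler_sumr -big_split; apply: eq_bigr => i _.
by rewrite scalerDl scalerA.
Qed.

Lemma slice_delta (k : nat) (j : 'I_k.+1) :
  slice (fun i => (i == j)%:R) = 'X^(k - j).
Proof.
rewrite /slice (bigD1 j)//= eqxx scale1r big1 ?addr0// => i /negbTE ->.
by rewrite scale0r.
Qed.

(** The coefficient [c ord0] is the leading one, so the second derivative has the odd degree k - 2
    and therefore a real root. This is where the parity of k enters. *)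
Lemma slice_deriv2_root (k : nat) (c : 'I_k.+1 -> R) :
  odd k -> (3 <= k)%N -> c ord0 != 0 -> exists m, (slice c)^`(2).[m] = 0.
Proof.
move=> ok k3 c0.
have ss : size (slice c) = k.+1.
  rewrite /slice big_ord_recl/= subn0 size_polyDl size_scale// size_polyXn//.
  rewrite (leq_ltn_trans (size_sum _ _ _))// ltnS; apply/bigmax_leqP => i _.
  by rewrite (leq_trans (size_scale_leq _ _))// size_polyXn /bump; lia.
have [m /rootP m0] : {x | root (slice c)^`(2) x}.
  apply: odd_poly_root; rewrite /= !polyorder.size_deriv ss.
  by case: k ok k3 {c c0 ss} => [|[|k]]//=; rewrite negbK.
by exists m.
Qed.

(** Adding t X to the slice keeps the zero m of the second derivative and moves the slope at m by t,
    so the slope vanishes for one t only. A polynomial vanishing on the class thus vanishes on a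
    line minus a point, hence on the line, hence at every b with [b ord0 != 0]. A second line, in
    the direction of the leading coefficient, removes this restriction. *)
Lemma zariski_dense_inflected (k : nat) :
  odd k -> (3 <= k)%N -> zariski_dense (@inflected k).
Proof.
move=> ok k3 _ [F ->] GF; apply/seteqP; split => // c _ p Fp.
have inflected_dense (b : 'I_k.+1 -> R) : b ord0 != 0 -> meval b p = 0.
  move=> b0; have [m m0] := slice_deriv2_root ok k3 b0.
  have lt1 : (k.-1 < k.+1)%N by lia.
  pose j := Ordinal lt1.
  have [Q QE] := meval_line p b (fun i => (i == j)%:R).
  have /poly_eq0_of_horner Q0 :
      forall t, t != - (slice b)^`().[m] -> Q.[t] = 0.
    move=> t tm; rewrite QE; apply: GF => //; exists m.
      rewrite slice_line slice_delta /= (_ : k - k.-1 = 1)%N; last by lia.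
      by rewrite expr1 derivD derivZ derivX derivD derivZ -[1]/(1%:P) derivC scaler0 addr0.
    rewrite slice_line slice_delta /= (_ : k - k.-1 = 1)%N; last by lia.
    rewrite expr1 derivD derivZ derivX hornerD hornerZ hornerC mulr1.
    by rewrite addrC addr_eq0.
  have := QE 0; rewrite Q0 horner0 => /esym.
  by under eq_fun do rewrite mul0r addr0.
have [Q QE] := meval_line p c (fun i => (i == ord0)%:R).
have /poly_eq0_of_horner Q0 : forall t, t != - c ord0 -> Q.[t] = 0.
  move=> t tc; rewrite QE; apply: inflected_dense.
  by rewrite eqxx mulr1 addrC addr_eq0.
have := QE 0; rewrite Q0 horner0 => /esym.
by under eq_fun do rewrite mul0r addr0.
Qed.

End zariski.

(** * Expansion of the symbol *)

Section expansion.
Variable R : realType.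

(** A big-O with one constant on all of D. In the final expansion D also contains the frequency N,
    so that the constant is uniform in N. *)
Definition dominated (T : Type) (D : set T) (f g : T -> R) : Prop :=
  exists2 C, 0 <= C & forall z, D z -> `|f z| <= C * g z.

Lemma dominated_sum (T I : Type) (D : set T) (s : seq I) (Q : pred I)
    (f : I -> T -> R) (g : T -> R) :
  (forall z, D z -> 0 <= g z) ->
  (forall i, Q i -> dominated D (f i) g) ->
  dominated D (fun z => \sum_(i <- s | Q i) f i z) g.
Proof.
move=> g0 fg; elim: s => [|i s [C C0 IH]].
  by exists 0 => // z Dz; rewrite big_nil normr0 mul0r.
case: (boolP (Q i)) => Qi; last first.
  by exists C => // z Dz; rewrite big_cons (negbTE Qi) IH.
have [B B0 fB] := fg _ Qi; exists (B + C); first exact: addr_ge0.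
move=> z Dz; rewrite big_cons Qi (le_trans (ler_normD _ _))// mulrDl lerD//.
  exact: fB.
exact: IH.
Qed.

Lemma dominatedZ (T : Type) (D : set T) (a : R) (f g : T -> R) :
  dominated D f g -> dominated D (fun z => a * f z) g.
Proof.
move=> [C C0 fC]; exists (`|a| * C); first exact: mulr_ge0.
by move=> z Dz; rewrite normrM -mulrA ler_wpM2l// fC.
Qed.

Lemma dominatedD (T : Type) (D : set T) (f1 f2 g1 g2 : T -> R) :
  (forall z, D z -> 0 <= g1 z) -> (forall z, D z -> 0 <= g2 z) ->
  dominated D f1 g1 -> dominated D f2 g2 ->
  dominated D (fun z => f1 z + f2 z) (fun z => g1 z + g2 z).
Proof.
move=> g10 g20 [C C0 fC] [B B0 fB]; exists (C + B); first exact: addr_ge0.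
move=> z Dz; rewrite (le_trans (ler_normD _ _))//.
rewrite (le_trans (lerD (fC _ Dz) (fB _ Dz)))// mulrDr !mulrDl.
by have := mulr_ge0 B0 (g10 z Dz); have := mulr_ge0 C0 (g20 z Dz); lra.
Qed.

Lemma expr_lipschitz (a : R) (n : nat) :
  exists2 C, 0 <= C & forall x, `|x| <= 1 -> `|(a + x) ^+ n - a ^+ n| <= C * `|x|.
Proof.
elim: n => [|n [C C0 IH]].
  by exists 0 => // x _; rewrite !expr0 subrr normr0 mul0r.
exists ((`|a| + 1) * C + `|a| ^+ n).
  by rewrite addr_ge0// mulr_ge0// addr_ge0.
move=> x x1; rewrite !exprS.
have -> : (a + x) * (a + x) ^+ n - a * a ^+ n =
    (a + x) * ((a + x) ^+ n - a ^+ n) + a ^+ n * x by ring.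
rewrite (le_trans (ler_normD _ _))// !normrM normrX mulrDl lerD//.
rewrite -mulrA ler_pM// ?IH// (le_trans (ler_normD _ _))// lerD//.
Qed.

Lemma monomial_lipschitz (a b : R) (i j : nat) :
  exists2 C, 0 <= C & forall x y, `|x| <= 1 -> `|y| <= 1 ->
    `|(a + x) ^+ i * (b + y) ^+ j - a ^+ i * b ^+ j| <= C * (`|x| + `|y|).
Proof.
have [A A0 hA] := expr_lipschitz a i; have [B B0 hB] := expr_lipschitz b j.
exists (A * (`|b| + 1) ^+ j + `|a| ^+ i * B).
  by rewrite addr_ge0// mulr_ge0// ?exprn_ge0// addr_ge0.
move=> x y x1 y1.
have -> : (a + x) ^+ i * (b + y) ^+ j - a ^+ i * b ^+ j =
  ((a + x) ^+ i - a ^+ i) * (b + y) ^+ j + a ^+ i * ((b + y) ^+ j - b ^+ j) by ring.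
have h1 : `|((a + x) ^+ i - a ^+ i) * (b + y) ^+ j| <= A * (`|b| + 1) ^+ j * `|x|.
  rewrite normrM mulrAC ler_pM//; first exact: hA.
  by rewrite normrX lerXn2r ?nnegrE ?addr_ge0// (le_trans (ler_normD _ _))// lerD.
have h2 : `|a ^+ i * ((b + y) ^+ j - b ^+ j)| <= `|a| ^+ i * B * `|y|.
  by rewrite normrM normrX -mulrA ler_wpM2l ?exprn_ge0// hB.
have p1 : 0 <= A * (`|b| + 1) ^+ j * `|y|.
  by rewrite !mulr_ge0// exprn_ge0// addr_ge0.
have p2 : 0 <= `|a| ^+ i * B * `|x| by rewrite !mulr_ge0// exprn_ge0.
rewrite (le_trans (ler_normD _ _))// (le_trans (lerD h1 h2))//.
by rewrite mulrDr !mulrDl; lra.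
Qed.

Lemma poly_taylor3 (q : {poly R}) (m : R) : q^`(2).[m] = 0 ->
  exists2 C, 0 <= C & forall y, `|y| <= 1 ->
    `|q.[m + y] - q.[m] - q^`().[m] * y| <= C * `|y| ^+ 3.
Proof.
move=> q2; have q2' : q^`N(2).[m] = 0.
  by move: q2; rewrite nderivn_def hornerMn => /eqP; rewrite mulrn_eq0 => /eqP.
exists (\sum_(i < size q) `|q^`N(i.+3).[m]|); first exact: sumr_ge0.
move=> y y1.
(* Expanding to [size q] plus 3 terms lets the first three be split off whatever the degree of q. *)
rewrite (@nderiv_taylor_wide _ (size q).+3)//; last 2 first.
- exact: mulrC.
- by rewrite -addn3 leq_addr.
rewrite 3!big_ord_recl/= !poly.nderivn1 poly.nderivn0 q2' expr0 expr1 mul0r mulr1 add0r.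
have -> (a b c : R) : a + (b + c) - a - b = c by ring.
rewrite (le_trans (ler_norm_sum _ _ _))// mulr_suml; apply: ler_sum => i _.
rewrite normrM ler_wpM2l// normrX /bump/= -[X in _ ^+ X]addn3 exprD.
by rewrite ler_piMl ?exprn_ge0// exprn_ile1.
Qed.

Lemma eval2E (P : mpoly.mpoly 2 R) (a b : R) : eval2 P (a, b) =
  \sum_(mm <- msupp P) mcoeff mm P * (a ^+ mm ord0 * b ^+ mm ord_max).
Proof.
rewrite /eval2 mevalE; apply: eq_bigr => mm _; congr (_ * _).
rewrite big_ord_recl big_ord1 eqxx; congr (_ * _).
by rewrite (_ : lift _ _ = ord_max)//; exact/val_inj.
Qed.

Lemma eval2_binary_form (k : nat) (c : 'I_k.+1 -> R) (a b : R) :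
  eval2 (binary_form c) (a, b) = \sum_(i < k.+1) c i * (a ^+ i * b ^+ (k - i)).
Proof.
rewrite /eval2 /binary_form raddf_sum; apply: eq_bigr => i _ /=.
by rewrite mevalZ rmorphM/= !rmorphXn/= !mevalXU.
Qed.

Lemma binary_form_expansion (k : nat) (c : 'I_k.+1 -> R) (m : R) :
  (slice c)^`(2).[m] = 0 ->
  dominated [set z : R * R | `|z.1| <= 1 /\ `|z.2| <= 1]
    (fun z => eval2 (binary_form c) (1 + z.1, m + z.2) - eval2 (binary_form c) (1, m)
              - (slice c)^`().[m] * z.2)
    (fun z => `|z.1| + `|z.2| ^+ 3).
Proof.
move=> c2; have sliceE b : eval2 (binary_form c) (1, b) = (slice c).[b].
  rewrite eval2_binary_form /slice horner_sum; apply: eq_bigr => i _.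
  by rewrite hornerZ hornerXn expr1n mul1r.
have [C C0 hC] := poly_taylor3 c2.
(* The increment is taken in two moves: [f] changes the first variable at height m + z.2, where a
   Lipschitz bound suffices, and the second variable then moves along the slice, where Taylor's
   formula without quadratic term applies. *)
pose f := fun z : R * R => \sum_(i < k.+1)
  c i * ((1 + z.1) ^+ i * (m + z.2) ^+ (k - i) - (m + z.2) ^+ (k - i)).
pose D := [set z : R * R | `|z.1| <= 1 /\ `|z.2| <= 1].
have h1 : dominated D f (fun z => `|z.1|).
  apply: dominated_sum => // i _; apply: dominatedZ.
  have [A A0 hA] := expr_lipschitz 1 i.
  exists (A * (`|m| + 1) ^+ (k - i)).
    by rewrite mulr_ge0// exprn_ge0// addr_ge0.
  move=> [x y] [/= x1 y1]; rewrite -{2}[(m + y) ^+ _]mul1r -mulrBl normrM mulrAC.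
  rewrite ler_pM//; first by have := hA _ x1; rewrite expr1n.
  rewrite normrX lerXn2r ?nnegrE ?addr_ge0//.
  by rewrite (le_trans (ler_normD _ _))// lerD.
have h2 : dominated D (fun z => (slice c).[m + z.2] - (slice c).[m]
                                - (slice c)^`().[m] * z.2) (fun z => `|z.2| ^+ 3).
  by exists C => // -[x y] [_ /= y1]; exact: hC.
have [B B0 hB] := dominatedD (fun _ _ => normr_ge0 _)
  (fun _ _ => exprn_ge0 _ (normr_ge0 _)) h1 h2.
exists B => // -[x y] Dxy; have := hB _ Dxy; rewrite /= !sliceE /f/=.
congr (`| _ | <= _); under eq_bigr do rewrite mulrBr.
rewrite sumrB -eval2_binary_form (_ : \sum_(i < k.+1) _ = (slice c).[m + y]); first ring.
by rewrite -sliceE eval2_binary_form; apply: eq_bigr => i _; rewrite expr1n mul1r.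
Qed.

Lemma binary_form_scale (k : nat) (c : 'I_k.+1 -> R) (N a b : R) :
  eval2 (binary_form c) (N * a, N * b) = N ^+ k * eval2 (binary_form c) (a, b).
Proof.
rewrite !eval2_binary_form mulr_sumr; apply: eq_bigr => i _.
have ik : (i <= k)%N by rewrite -ltnS.
have -> : N ^+ k = N ^+ i * N ^+ (k - i) by rewrite -exprD subnKC.
by rewrite !exprMn; ring.
Qed.

Lemma mdeg2 (mm : multinom 2) : mdeg mm = (mm ord0 + mm ord_max)%N.
Proof.
rewrite mdegE big_ord_recl big_ord1; congr (_ + mm _)%N.
exact/val_inj.
Qed.

(* The quadratic term in [z.2.2] is missing since [m] is a zero of the second
   derivative of the leading form. *)
Lemma polynomial_expansion (k : nat) (P : mpoly.mpoly 2 R) (c : 'I_k.+1 -> R) (m : R) :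
  (0 < k)%N -> has_degree P k -> pihomog mdeg k P = binary_form c ->
  (slice c)^`(2).[m] = 0 ->
  dominated [set z : R * (R * R) | [/\ 1 <= z.1, `|z.2.1| <= 1 & `|z.2.2| <= 1]]
    (fun z => eval2 P (z.1 * (1 + z.2.1), z.1 * (m + z.2.2)) - eval2 P (z.1, z.1 * m)
              - z.1 ^+ k * (slice c)^`().[m] * z.2.2)
    (fun z => z.1 ^+ k * (`|z.2.1| + `|z.2.2| ^+ 3) + z.1 ^+ k.-1 * (`|z.2.1| + `|z.2.2|)).
Proof.
move=> k0 Pk Pc c2; set D := (X in dominated X).
have split a b : eval2 P (a, b) = eval2 (binary_form c) (a, b) +
    \sum_(mm <- msupp P | mdeg mm != k) mcoeff mm P * (a ^+ mm ord0 * b ^+ mm ord_max).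
  rewrite eval2E (bigID (fun mm => mdeg mm == k))/=; congr (_ + _).
  rewrite -Pc pihomogE /eval2 raddf_sum/=; apply: eq_bigr => mm _.
  rewrite mevalZ mevalX big_ord_recl big_ord1 eqxx; congr (_ * (_ * _)).
  by rewrite (_ : lift _ _ = ord_max)//; exact/val_inj.
have [C C0 hC] := binary_form_expansion c2.
have h1 : dominated D (fun z =>
    eval2 (binary_form c) (z.1 * (1 + z.2.1), z.1 * (m + z.2.2))
    - eval2 (binary_form c) (z.1 * 1, z.1 * m)
    - z.1 ^+ k * (slice c)^`().[m] * z.2.2)
    (fun z => z.1 ^+ k * (`|z.2.1| + `|z.2.2| ^+ 3)).
  exists C => // -[N [x y]] [/= N1 x1 y1].
  rewrite !binary_form_scale -mulrBr -mulrA -mulrBr normrM mulrCA ger0_norm.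
    by rewrite ler_wpM2l ?exprn_ge0 ?(le_trans _ N1)//; exact: (hC (x, y)).
  by rewrite exprn_ge0// (le_trans _ N1).
(* In the lower-order monomials no cancellation is sought: each is Lipschitz after scaling, and its
   factor N^deg is at most N^(k-1) because N >= 1. *)
have h2 : dominated D (fun z => \sum_(mm <- msupp P | (mdeg mm < k)%N) mcoeff mm P *
      ((z.1 * (1 + z.2.1)) ^+ mm ord0 * (z.1 * (m + z.2.2)) ^+ mm ord_max
       - (z.1 * 1) ^+ mm ord0 * (z.1 * m) ^+ mm ord_max))
    (fun z => z.1 ^+ k.-1 * (`|z.2.1| + `|z.2.2|)).
  apply: dominated_sum => [[N [x y]] [/= N1 _ _]|mm mmk].
    by rewrite mulr_ge0 ?addr_ge0// exprn_ge0// (le_trans _ N1).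
  apply: dominatedZ.
  have [A A0 hA] := monomial_lipschitz 1 m (mm ord0) (mm ord_max).
  exists A => // -[N [x y]] [/= N1 x1 y1]; have N0 : 0 <= N by rewrite (le_trans _ N1).
  have -> : (N * (1 + x)) ^+ mm ord0 * (N * (m + y)) ^+ mm ord_max
       - (N * 1) ^+ mm ord0 * (N * m) ^+ mm ord_max = N ^+ mdeg mm *
      ((1 + x) ^+ mm ord0 * (m + y) ^+ mm ord_max - 1 ^+ mm ord0 * m ^+ mm ord_max).
    by rewrite mdeg2 exprD !exprMn; ring.
  rewrite normrM mulrCA ler_pM// ?hA// ger0_norm ?exprn_ge0//.
  by rewrite ler_weXn2l//; lia.
have g1 z : D z -> 0 <= z.1 ^+ k * (`|z.2.1| + `|z.2.2| ^+ 3).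
  case: z => [N [x y]] [/= N1 _ _].
  by rewrite mulr_ge0 ?addr_ge0 ?exprn_ge0// (le_trans _ N1).
have g2 z : D z -> 0 <= z.1 ^+ k.-1 * (`|z.2.1| + `|z.2.2|).
  case: z => [N [x y]] [/= N1 _ _].
  by rewrite mulr_ge0 ?addr_ge0 ?exprn_ge0// (le_trans _ N1).
have [B B0 hB] := dominatedD g1 g2 h1 h2.
exists B => // -[N [x y]] Dz; move: (hB _ Dz) => /=; rewrite !split mulr1.
(* All monomials in the support have degree at most k, so the conditions [!= k] and [< k] select the
   same ones. *)
have low u v : \sum_(mm <- msupp P | (mdeg mm < k)%N) mcoeff mm P *
      (u ^+ mm ord0 * v ^+ mm ord_max) =
    \sum_(mm <- msupp P | mdeg mm != k) mcoeff mm P *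
      (u ^+ mm ord0 * v ^+ mm ord_max).
  rewrite big_seq_cond [RHS]big_seq_cond; apply: eq_bigl => mm.
  case: (boolP (mm \in msupp P)) => //= mmP; rewrite ltn_neqAle; case: eqP => //= _.
  by rewrite -ltnS -Pk; exact: (@mmeasure_mnm_lt _ _ mdeg).
under eq_bigr do rewrite mulrBr.
rewrite sumrB !low; set s1 := \sum_(_ <- _ | _) _; set s2 := \sum_(_ <- _ | _) _.
set e1 := eval2 _ _; set e2 := eval2 _ _; set g := _ * y.
by rewrite (_ : e1 - e2 - g + (s1 - s2) = e1 + s1 - (e2 + s2) - g)//; ring.
Qed.

End expansion.

(** * Integration on the plane *)

Section tensor.
Context d1 d2 (T1 : measurableType d1) (T2 : measurableType d2) (R : realType).
Variables (m1 : {sigma_finite_measure set T1 -> \bar R}).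
Variables (m2 : {sigma_finite_measure set T2 -> \bar R}).
Variables (A : T1 -> R) (B : T2 -> R).
Hypotheses (iA : m1.-integrable setT (EFin \o A)) (iB : m2.-integrable setT (EFin \o B)).

Let mA : measurable_fun setT A.
Proof. by move/measurable_int : iA => /measurable_EFinP. Qed.
Let mB : measurable_fun setT B.
Proof. by move/measurable_int : iB => /measurable_EFinP. Qed.

Lemma integrable_tensor : (m1 \x m2)%E.-integrable setT (fun x => (A x.1 * B x.2)%:E).
Proof.
apply/(@integrable12ltyP _ _ _ _ R m1 m2) => /=.
  apply/measurable_EFinP/measurable_funM; apply: measurableT_comp => //.
move/integrableP : iA => [_ iA']; move/integrableP : iB => [_ iB'].
under eq_integral => x _.
  under eq_integral => y _ do rewrite normrM EFinM.
  rewrite ge0_integralZl//; last by apply/measurable_EFinP; exact: measurableT_comp.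
  over.
rewrite ge0_integralZr//; last 2 first.
- by apply/measurable_EFinP; exact: measurableT_comp.
- by apply: integral_ge0 => x _; rewrite lee_fin.
have I0 d (T : measurableType d) (m : {measure set T -> \bar R}) (f : T -> R) :
    (0 <= \int[m]_x `|f x|%:E)%E.
  by apply: integral_ge0 => x _; rewrite lee_fin.
by rewrite lte_mul_pinfty// ge0_fin_numE.
Qed.

Lemma Rintegral_tensor :
  \int[(m1 \x m2)%E]_x (A x.1 * B x.2) = (\int[m1]_x A x) * (\int[m2]_x B x).
Proof.
rewrite [LHS]/Rintegral -(@integral12_prod_meas1 _ _ _ _ R m1 m2); last exact: integrable_tensor.
transitivity (fine (\int[m1]_x ((\int[m2]_y B y)%:E * (A x)%:E))%E).
  congr fine; apply: eq_integral => x _; rewrite /fubini_F/=.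
  under eq_integral do rewrite EFinM.
  by rewrite integralZl// muleC /Rintegral fineK// integrable_fin_num.
by rewrite integralZl// [X in (_ * X)%E](_ : _ = (\int[m1]_x A x)%:E)/= 1?mulrC//
  /Rintegral fineK// integrable_fin_num.
Qed.

End tensor.

Section Rintegral_Fubini.
Context d1 d2 (T1 : measurableType d1) (T2 : measurableType d2) (R : realType).
Variables (m1 : {sigma_finite_measure set T1 -> \bar R}).
Variables (m2 : {sigma_finite_measure set T2 -> \bar R}).
Variable k : T1 -> T2 -> R.
Hypothesis ik : (m1 \x m2)%E.-integrable setT (fun z => (k z.1 z.2)%:E).
Hypothesis ik1 : forall x, m2.-integrable setT (EFin \o k x).

Let inner : fubini_F m2 (fun z => (k z.1 z.2)%:E) = EFin \o (fun x => \int[m2]_y k x y).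
Proof.
apply/funext => x; rewrite /fubini_F /= /Rintegral fineK//.
exact: integrable_fin_num (ik1 x).
Qed.

Lemma integrable_Rintegral : m1.-integrable setT (EFin \o (fun x => \int[m2]_y k x y)).
Proof. by rewrite -inner; exact: integrable_fubini_F. Qed.

(** The real integral is [fine] of the extended one, and [fine] sends infinite values to 0.
    Integrability of every section, not just of almost every one, keeps the inner integrals finite,
    so that the extended Fubini theorem carries over. *)
Lemma Rintegral_Fubini : (forall y, m1.-integrable setT (EFin \o (k ^~ y))) ->
  \int[m1]_x (\int[m2]_y k x y) = \int[m2]_y (\int[m1]_x k x y).
Proof.
move=> ik2; rewrite {1}/Rintegral.
have -> : (\int[m1]_x (\int[m2]_y k x y)%:E = \int[m1]_x \int[m2]_y (k x y)%:E)%E.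
  apply: eq_integral => x _; rewrite /Rintegral fineK//; exact: integrable_fin_num (ik1 x).
have := Fubini ik; rewrite /= => ->; congr fine.
apply: eq_integral => y _; rewrite /Rintegral fineK//; exact: integrable_fin_num (ik2 y).
Qed.

End Rintegral_Fubini.

Section plane_measure.
Variable R : realType.
Let mu : {sigma_finite_measure set (measurableTypeR R) -> \bar R} := @lebesgue_measure R.

Lemma sigma_finite_leb2 : sigma_finite setT (leb2 R).
Proof.
have /sigma_finiteP[F [TF ndF Foo]] := sigma_finiteT mu.
exists (fun n => F n `*` F n).
  rewrite -setXTT TF predeqE => -[x y]; split.
    move=> [/= [n _ Fnx] [k _ Gky]]; exists (maxn n k) => //; split.
    - by move: x Fnx; exact/subsetPset/ndF/leq_maxl.
    - by move: y Gky; exact/subsetPset/ndF/leq_maxr.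
  by move=> [n _ []/= ? ?]; split; exists n.
move=> k; have [? ?] := Foo k.
split; first exact: measurableX.
by rewrite product_measure1E// lte_mul_pinfty// ge0_fin_numE.
Qed.

(* The library registers [product_measure1] as a sigma-finite measure only
   through its sub-probability instance. *)
Definition mu2 := HB.pack_for {sigma_finite_measure set (plane R) -> \bar R}
  (leb2 R) (Measure_isSigmaFinite.Build _ _ _ (leb2 R) sigma_finite_leb2).

(** The plane carries the product sigma-algebra, so openness in the product topology has to be
    reached by countable unions: U is the union of the squares with rational centre and radius
    1/(n+1) that it contains. *)
Lemma open_measurable_plane (U : set (R * R)) :
  open U -> measurable (U : set (plane R)).
Proof.
move=> oU.
pose r (n : nat) : R := n.+1%:R^-1.
pose B (p q : rat) (n : nat) : set (plane R) :=
  ball (ratr p : R) (r n) `*` ball (ratr q : R) (r n).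
pose S p q n : set (plane R) := [set z | B p q n z /\ B p q n `<=` U].
suff -> : U = \bigcup_p \bigcup_q \bigcup_n S p q n :> set (plane R).
  apply: bigcupT_measurable_rat => p; apply: bigcupT_measurable_rat => q.
  apply: bigcupT_measurable => n; have [BU|BU] := pselect (B p q n `<=` U).
    rewrite (_ : S p q n = B p q n); last by apply/seteqP; split => [z []|].
    by apply: measurableX; exact: measurable_ball.
  by rewrite (_ : S p q n = set0)//; apply/seteqP; split => [z []|].
apply/seteqP; split => [[x y] Uxy|z [p _ [q _ [n _]]]]; last first.
  by move=> [Bz]; apply.
have /nbhs_ballP[e /= e0 eU] : nbhs (x, y) U by apply: open_nbhs_nbhs; split.
pose n := Num.truncn (2 * e^-1).
have ne : r n + r n < e.
  rewrite -mulr2n -mulr_natr -ltr_pdivlMr// -[ltRHS]invrK /r.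
  by rewrite ltf_pV2 ?posrE ?invr_gt0 ?divr_gt0// invf_div truncnS_gt.
have [p pxr] : exists p, ratr p \in `](x - r n), (x + r n)[%R.
  by apply: rat_in_itvoo; rewrite ltrD2l gtrN// invr_gt0.
have [q qyr] : exists q, ratr q \in `](y - r n), (y + r n)[%R.
  by apply: rat_in_itvoo; rewrite ltrD2l gtrN// invr_gt0.
have xp : `|ratr p - x| < r n by rewrite ltr_distl; move: pxr; rewrite in_itv.
have yq : `|ratr q - y| < r n by rewrite ltr_distl; move: qyr; rewrite in_itv.
exists p => //; exists q => //; exists n => //; split=> //.
move=> [u v] [/= pu qv]; apply: eU; split => /=; rewrite /ball/= in pu qv *.
  rewrite (le_lt_trans _ ne)// (le_trans (ler_distD (ratr p) _ _))//.
  by rewrite lerD// ltW// distrC.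
rewrite (le_lt_trans _ ne)// (le_trans (ler_distD (ratr q) _ _))//.
by rewrite lerD// ltW// distrC.
Qed.

Lemma continuous_measurable_plane (f : R * R -> R) :
  continuous f -> measurable_fun (setT : set (plane R)) f.
Proof.
move=> /continuousP cf; apply: (measurability _ (RGenOpens.measurableE R)).
move=> _ [_ [a [b ->] <-]]; rewrite setTI; apply: open_measurable_plane.
exact/cf/interval_open.
Qed.

(** The measure a mu, pushed forward along multiplication by a, agrees with Lebesgue measure on
    half-open intervals and hence everywhere; the formula is the change of variables for this
    push-forward. *)
Lemma ge0_integral_scale (a : R) (f : R -> R) : 0 < a ->
  measurable_fun setT f -> (forall x, 0 <= f x) ->
  (\int[mu]_x (f (a * x))%:E = a^-1%:E * \int[mu]_x (f x)%:E)%E.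
Proof.
move=> a0 mf f0.
have a'0 : 0 <= a^-1 by rewrite invr_ge0 ltW.
have ma : measurable_fun setT ( *%R a : measurableTypeR R -> measurableTypeR R).
  exact: mulrl_measurable.
have mf' : measurable_fun setT (EFin \o f) by exact/measurable_EFinP.
have := @ge0_integral_mscale _ _ R mu setT measurableT (NngNum a'0) (EFin \o f) mf'
  (fun x _ => f0 x); rewrite /= => <-.
have := @ge0_integral_pushforward _ _ _ _ R _ ma mu setT (EFin \o f) measurableT mf'
  (fun x _ => f0 x); rewrite /= preimage_setT => <-.
apply: eq_measure_integral => X mX _ /=; rewrite /mscale/=.
suff : pushforward (mscale (NngNum (ltW a0)) mu)
    ( *%R a : measurableTypeR R -> measurableTypeR R) X = mu X.
  rewrite /pushforward /mscale/= => <-.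
  by rewrite muleA -EFinM mulVf ?gt_eqF// mul1e.
apply/esym/lebesgue_measure_unique => //= _ [[u v]] _ <-.
rewrite /pushforward /mscale/=.
rewrite (_ : *%R a @^-1` _ = `](a^-1 * u), (a^-1 * v)]%classic).
  rewrite !lebesgue_measure_itv/= !lte_fin ltr_pM2l ?invr_gt0//; case: ifP => uv.
    by rewrite -!EFinB -EFinM -mulrBr mulrA mulfV ?gt_eqF// mul1r.
  by rewrite mule0.
apply/seteqP; split => x/=; rewrite !in_itv/= ltr_pdivrMl// ler_pdivlMl//.
Qed.

End plane_measure.

(** * The Fejer kernel *)

Lemma integrable_mul_bounded d (T : measurableType d) (R : realType)
    (m : {measure set T -> \bar R}) (f h : T -> R) (M : R) :
  m.-integrable setT (EFin \o f) -> measurable_fun setT h ->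
  (forall x, `|h x| <= M) -> m.-integrable setT (EFin \o (fun x => f x * h x)).
Proof.
move=> fi mh hM; have mf : measurable_fun setT f.
  by move/measurable_int : fi => /measurable_EFinP.
have M0 x : 0 <= M := le_trans (normr_ge0 _) (hM x).
apply: (@le_integrable _ _ _ m _ measurableT _ (fun x => M%:E * (EFin \o f) x)%E).
- by apply/measurable_EFinP; exact: measurable_funM.
- move=> x _; rewrite /= lee_fin !normrM mulrC (ger0_norm (M0 x)).
  by rewrite ler_wpM2r.
- exact: integrableZl.
Qed.

Lemma integrable_scale d (T : measurableType d) (R : realType)
    (m : {measure set T -> \bar R}) (c : R) (f : T -> R) :
  m.-integrable setT (EFin \o f) -> m.-integrable setT (EFin \o (fun x => c * f x)).
Proof. exact: integrableZl. Qed.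

Section fejer.
Variable R : realType.
Let mu : {sigma_finite_measure set (measurableTypeR R) -> \bar R} := @lebesgue_measure R.

Lemma sinr_le (x : R) : `|sin x| <= `|x|.
Proof.
suff H (y : R) : 0 < y -> `|sin y| <= y.
  have [x0|x0|->] := ltrgtP x 0; last by rewrite sin0.
    by rewrite -(normrN (sin x)) -sinN -(normrN x) (@ger0_norm _ (- x))
      ?oppr_ge0 ?H ?oppr_gt0 ?(ltW x0).
  by rewrite (ger0_norm (ltW x0)) H.
move=> y0; have [c _] := @MVT R sin cos 0 y y0 (fun x _ => is_derive_sin x)
  (continuous_subspaceT (@continuous_sin R)).
rewrite sin0 !subr0 => ->; rewrite normrM (ger0_norm (ltW y0)).
by rewrite ler_piMl ?(ltW y0)// cos_max.
Qed.

Lemma onem_cos_le (x : R) : 1 - cos x <= x ^+ 2 / 2.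
Proof.
have {1}-> : x = (x / 2) *+ 2 by rewrite -mulr_natr divfK.
rewrite cos_mulr2n; have := cos2Dsin2 (x / 2).
have : sin (x / 2) ^+ 2 <= (x / 2) ^+ 2.
  by rewrite -(real_normK (num_real (sin _))) -(real_normK (num_real (x / 2)))
    lerXn2r ?nnegrE ?sinr_le.
rewrite -mulr_natr; set c := cos _ ^+ 2; set s := sin _ ^+ 2.
by move=> h1 h2; lra.
Qed.

Lemma cos_ge_half (x : R) : `|x| <= 1 -> 2^-1 <= cos x.
Proof.
move=> x1; have := onem_cos_le x.
have : x ^+ 2 <= 1 by rewrite -real_normK ?num_real// exprn_ile1.
lra.
Qed.

Lemma integrable_oneDsqrV : mu.-integrable setT (EFin \o (fun x => (1 + x ^+ 2)^-1)).
Proof.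
have c : continuous (fun x : R => (1 + x ^+ 2)^-1) by exact: continuous_oneDsqrV.
have p (x : R) : 0 <= (1 + x ^+ 2)^-1.
  by rewrite invr_ge0 addr_ge0// sqr_ge0.
apply/integrableP; split.
  by apply/measurable_EFinP; exact: continuous_measurable_fun.
under eq_integral => x _ do rewrite /= ger0_norm//.
rewrite (@ge0_symfun_integralT R (fun x => (1 + x ^+ 2)^-1))//; last first.
  by move=> x; rewrite /= sqrrN.
rewrite (_ : [set x : R | 0 <= x] = `[0, +oo[%classic); last first.
  by apply/seteqP; split => x /=; rewrite in_itv/= andbT.
have := @integral0y_oneDsqr R; rewrite /oneDsqr => ->.
by rewrite -EFinM ltry.
Qed.

(* Its value at 0 is 0 (division by zero) and not the limit a^2 / 2, which is
   harmless under the integral. *)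
Definition fejer (a x : R) : R := (1 - cos (a * x)) / x ^+ 2.

Lemma fejer_ge0 a x : 0 <= fejer a x.
Proof. by rewrite divr_ge0 ?sqr_ge0// subr_ge0 cos_le1. Qed.

(** For x^2 <= 1 the bound 1 - cos(a x) <= a^2 x^2 / 2 gives the term a^2, and for larger x the
    bound 1 - cos(a x) <= 2 gives the term 4. *)
Lemma fejer_le a x : fejer a x <= (a ^+ 2 + 4) * (1 + x ^+ 2)^-1.
Proof.
have x20 : 0 <= x ^+ 2 := sqr_ge0 x; have a20 : 0 <= a ^+ 2 := sqr_ge0 a.
rewrite ler_pdivlMr; last by rewrite ltr_pwDl.
have [->|x0] := eqVneq x 0.
  by rewrite /fejer expr0n/= invr0 mulr0 mul0r; lra.
have x2 : 0 < x ^+ 2 by rewrite exprn_even_gt0.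
rewrite /fejer mulrAC ler_pdivrMr//.
have h1 := onem_cos_le (a * x); rewrite exprMn in h1.
have h2 := cos_geN1 (a * x); have h3 := cos_le1 (a * x).
set c := cos _ in h1 h2 h3 *; set X := x ^+ 2 in x20 x2 h1 *.
set B := a ^+ 2 in a20 h1 *.
have BX : 0 <= B * X by exact: mulr_ge0.
have [X1|X1] := leP X 1.
  have : (1 - c) * (1 + X) <= (1 - c) * 2 by rewrite ler_wpM2l//; lra.
  by move=> ?; lra.
have : (1 - c) * (1 + X) <= 2 * (1 + X) by rewrite ler_wpM2r//; lra.
by move=> ?; lra.
Qed.

Lemma measurable_fejer a : measurable_fun setT (fejer a).
Proof.
apply: measurable_funM.
  apply: measurable_funB => //; apply: measurableT_comp.
    by apply: continuous_measurable_fun; exact: continuous_cos.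
  exact: mulrl_measurable.
under eq_fun do rewrite -powR_inv1 ?sqr_ge0//.
apply: (@measurableT_comp _ _ _ _ _ _ (@powR R ^~ (-1)) _ (fun x : R => x ^+ 2)).
  exact: measurable_powR.
exact: exprn_measurable.
Qed.

Lemma integrable_fejer a : mu.-integrable setT (EFin \o fejer a).
Proof.
apply: (@le_integrable _ _ _ mu _ measurableT _ _ _ _
  (integrable_scale (a ^+ 2 + 4) integrable_oneDsqrV)).
  by apply/measurable_EFinP; exact: measurable_fejer.
move=> x _; rewrite lee_fin ger0_norm ?fejer_ge0// (le_trans (fejer_le _ _))//.
exact: ler_norm.
Qed.

Lemma Rintegral_indic_itv (a b : R) : a <= b ->
  \int[mu]_x (\1_(`[a, b]%classic : set R) x) = b - a.
Proof.
move=> ab; rewrite /Rintegral integral_indic//.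
rewrite setIT /mu/= lebesgue_measure_itv/= lte_fin.
by move: ab; rewrite le_eqVlt => /predU1P[->|->//]; rewrite ltxx subrr.
Qed.

(** The classical value is pi. *)
Definition fejer_mass : R := \int[mu]_x fejer 1 x.

Lemma fejer_scale a x : fejer a x = a ^+ 2 * fejer 1 (a * x).
Proof.
have [->|a0] := eqVneq a 0; first by rewrite /fejer !mul0r cos0 subrr mul0r expr0n mul0r.
by rewrite /fejer mul1r exprMn (invfM (a ^+ 2)) [X in _ = _ * X]mulrCA mulVKf ?expf_neq0.
Qed.

Lemma fejer_abs a x : fejer `|a| x = fejer a x.
Proof. by rewrite /fejer -cos_norm normrM normr_id -normrM cos_norm. Qed.

Lemma Rintegral_fejer a : \int[mu]_x fejer a x = `|a| * fejer_mass.
Proof.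
under eq_Rintegral do rewrite -fejer_abs.
have := normr_ge0 a; rewrite le_eqVlt => /predU1P[<-|a0].
  rewrite mul0r (_ : (fun x => _) = cst 0); first by rewrite Rintegral_cst// mul0r.
  by apply/funext => x; rewrite fejer_scale expr0n mul0r.
rewrite /Rintegral; under eq_integral do rewrite fejer_scale EFinM.
rewrite ge0_integralZl//; last 2 first.
- apply/measurable_EFinP; apply: (measurableT_comp (measurable_fejer 1)).
  exact: mulrl_measurable.
- by move=> x _; rewrite lee_fin fejer_ge0.
rewrite (@ge0_integral_scale R _ (fejer 1))//; last 2 first.
- exact: measurable_fejer.
- exact: fejer_ge0.
rewrite muleA -EFinM expr2 mulfK ?gt_eqF// fineM//.
exact/integrable_fin_num/integrable_fejer.
Qed.

Lemma fejer_mass_gt0 : 0 < fejer_mass.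
Proof.
(* A lower bound for the kernel on [1, 2]: cos decreases there, as 2 <= pi, and x^2 <= 4. *)
pose c : R := (1 - cos 1) / 4.
have c0 : 0 < c.
  rewrite divr_gt0// subr_gt0 -[ltRHS]cos0 ltr_cos ?in_itv/= ?lexx ?pi_ge0 ?ler01//.
  by rewrite (le_trans _ (pi_ge2 R))// ler1n.
have i12 : mu.-integrable setT (EFin \o (fun x => c * \1_(`[1, 2]%classic : set R) x)).
  by apply: integrable_scale; exact: integrable_indic_itv.
suff : \int[mu]_x (c * \1_(`[1, 2]%classic : set R) x) <= fejer_mass.
  apply: lt_le_trans; rewrite RintegralZl//; last exact: integrable_indic_itv.
  by rewrite mulr_gt0// Rintegral_indic_itv ?ler1n// subr_gt0 ltr1n.
apply: le_Rintegral => //; first exact: integrable_fejer.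
move=> x _; rewrite indicE; case: (boolP (x \in _)); last by rewrite mulr0 fejer_ge0.
rewrite inE/= in_itv/= mulr1 => /andP[x1 x2]; rewrite /fejer mul1r /c.
have cx : cos x <= cos 1.
  rewrite leNgt ltr_cos ?in_itv/= -?leNgt//.
  - by rewrite (le_trans ler01)//= (le_trans x2)// pi_ge2.
  - by rewrite ler01 (le_trans _ (pi_ge2 R))// ler1n.
apply: ler_pM.
- by rewrite subr_ge0 cos_le1.
- by rewrite invr_ge0.
- by rewrite lerD2l lerN2.
- rewrite lef_pV2 ?posrE ?exprn_gt0 ?(lt_le_trans _ x1)//.
  have : 0 <= (2 - x) * (2 + x) by rewrite mulr_ge0//; lra.
  by move=> ?; lra.
Qed.

Lemma Rintegral_opp (f : R -> R) : mu.-integrable setT (EFin \o f) ->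
  mu.-integrable setT (EFin \o (fun x => f (- x))) ->
  \int[mu]_x f (- x) = \int[mu]_x f x.
Proof.
move=> fi fNi; have mf : measurable_fun setT (EFin \o f) by exact: measurable_int fi.
have mN : measurable_fun setT (-%R : measurableTypeR R -> measurableTypeR R).
  exact: oppr_measurable.
have := @integral_pushforward _ _ _ _ R _ mN mu setT (EFin \o f) mf.
rewrite preimage_setT => /(_ fNi measurableT) => e.
rewrite /Rintegral -[in LHS]/(_ \o -%R) -e; congr fine.
by apply: eq_measure_integral => A mA _; exact: lebesgue_measureN.
Qed.

Definition tent (a y : R) : R := Num.max (a - `|y|) 0.

Lemma measurable_cos_mul (y : R) : measurable_fun setT (fun x : R => cos (x * y)).
Proof.
apply: (@measurableT_comp _ _ _ _ _ _ (@cos R)).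
  by apply: continuous_measurable_fun; exact: continuous_cos.
exact: mulrr_measurable.
Qed.

Lemma measurable_sin_mul (y : R) : measurable_fun setT (fun x : R => sin (x * y)).
Proof.
apply: (@measurableT_comp _ _ _ _ _ _ (@sin R)).
  by apply: continuous_measurable_fun; exact: continuous_sin.
exact: mulrr_measurable.
Qed.

Lemma integrable_fejer_cos a y :
  mu.-integrable setT (EFin \o (fun x => fejer a x * cos (x * y))).
Proof.
apply: (integrable_mul_bounded (integrable_fejer a) (measurable_cos_mul y)) => x.
exact: cos_max.
Qed.

Lemma integrable_fejer_sin a y :
  mu.-integrable setT (EFin \o (fun x => fejer a x * sin (x * y))).
Proof.
apply: (integrable_mul_bounded (integrable_fejer a) (measurable_sin_mul y)) => x.
exact: sin_max.
Qed.

(* [fejer a x * cos (x * y)] is a linear combination of [fejer b x] for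
   b = a + y, a - y, y, and the integral of [fejer b] is proportional to |b| by
   scaling, so that the value of the constant [fejer_mass] is not needed. *)
Lemma Rintegral_fejer_cos a y : 0 <= a ->
  \int[mu]_x (fejer a x * cos (x * y)) = fejer_mass * tent a y.
Proof.
move=> a0; transitivity (\int[mu]_x ((2^-1 * fejer (a + y) x + 2^-1 * fejer (a - y) x)
                                       - fejer y x)).
  apply: eq_Rintegral => x _.
  rewrite /fejer (mulrDl a y) (mulrDl a (- y)) mulNr cosB cosD (mulrC x y).
  by set u := (x ^+ 2)^-1; field.
have i1 b : mu.-integrable setT (EFin \o (fun x => 2^-1 * fejer b x)).
  by apply: integrable_scale; exact: integrable_fejer.
rewrite RintegralB//; last 2 first.
- exact: integrableD (i1 _) (i1 _).
- exact: integrable_fejer.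
rewrite RintegralD// !RintegralZl//; try exact: integrable_fejer.
rewrite !Rintegral_fejer /tent.
set k := fejer_mass.
have -> : 2^-1 * (`|a + y| * k) + 2^-1 * (`|a - y| * k) - `|y| * k =
  k * ((`|a + y| + `|a - y|) / 2 - `|y|) by field.
congr (_ * _).
(* For a >= 0, the half-sum of |a + y| and |a - y| is max(a, |y|), and subtracting |y| leaves the
   tent. *)
case: (ger0P y) => y0.
  rewrite (ger0_norm (_ : 0 <= a + y)) ?addr_ge0//.
  case: (ger0P (a - y)) => ay; lra.
rewrite (ger0_norm (_ : 0 <= a - y)); last by lra.
rewrite opprK; case: (ger0P (a + y)) => ay; lra.
Qed.

Lemma Rintegral_fejer_sin a y : \int[mu]_x (fejer a x * sin (x * y)) = 0.
Proof.
have odd x : fejer a (- x) * sin (- x * y) = - (fejer a x * sin (x * y)).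
  by rewrite /fejer mulrN cosN sqrrN mulNr sinN mulrN.
have iN : mu.-integrable setT (EFin \o (fun x => fejer a (- x) * sin (- x * y))).
  under eq_fun do rewrite odd -mulN1r.
  by apply: integrable_scale; exact: integrable_fejer_sin.
have := Rintegral_opp (integrable_fejer_sin a y) iN.
rewrite (_ : (fun x => _) = (fun x => - 1 * (fejer a x * sin (x * y)))); last first.
  by apply/funext => x; rewrite odd mulN1r.
rewrite RintegralZl//; last exact: integrable_fejer_sin.
by rewrite mulN1r => ?; lra.
Qed.

End fejer.

(** * Complex-valued integrals *)

Section complex_tools.
Variable R : realType.
Local Notation Re := complex.Re.
Local Notation Im := complex.Im.
Implicit Types z w : R[i].

Lemma ReM z w : Re (z * w) = Re z * Re w - Im z * Im w.
Proof. by case: z => a b; case: w => c d. Qed.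

Lemma ImM z w : Im (z * w) = Re z * Im w + Im z * Re w.
Proof. by case: z => a b; case: w => c d. Qed.

Lemma Re_cexpi t : Re (cexpi t : R[i]) = cos t. Proof. by []. Qed.
Lemma Im_cexpi t : Im (cexpi t : R[i]) = sin t. Proof. by []. Qed.

Lemma cexpiD (s t : R) : cexpi (s + t) = cexpi s * cexpi t :> R[i].
Proof.
apply/eqP; rewrite eq_complex ReM ImM !Re_cexpi !Im_cexpi cosD sinD.
by rewrite eqxx/= addrC.
Qed.

Lemma cmodE z : cmod z = Num.sqrt (Re z ^+ 2 + Im z ^+ 2).
Proof. by case: z. Qed.

Lemma cmod_ge0 z : 0 <= cmod z.
Proof. by rewrite cmodE sqrtr_ge0. Qed.

Lemma cmodM z w : cmod (z * w) = cmod z * cmod w.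
Proof. exact: ComplexField.Normc.normcM. Qed.

Lemma cmod_cexpi (t : R) : cmod (cexpi t) = 1.
Proof. by rewrite cmodE Re_cexpi Im_cexpi cos2Dsin2 sqrtr1. Qed.

Lemma Re_le_cmod z : `|Re z| <= cmod z.
Proof.
rewrite cmodE -sqrtr_sqr ler_sqrt ?lerDl ?sqr_ge0//.
by rewrite addr_ge0 ?sqr_ge0.
Qed.

Lemma Im_le_cmod z : `|Im z| <= cmod z.
Proof.
rewrite cmodE -sqrtr_sqr ler_sqrt ?lerDr ?sqr_ge0//.
by rewrite addr_ge0 ?sqr_ge0.
Qed.

Lemma cmod_le z : cmod z <= `|Re z| + `|Im z|.
Proof.
rewrite cmodE -[leRHS]ger0_norm ?addr_ge0// -sqrtr_sqr ler_sqrt ?sqr_ge0//.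
rewrite sqrrD !real_normK ?num_real// lerD2r lerDl.
by rewrite mulrn_wge0// mulr_ge0.
Qed.

Lemma cmod_real (a : R) : cmod (real_complex R a) = `|a|.
Proof. by rewrite cmodE /= expr0n/= addr0 sqrtr_sqr. Qed.

Section integration.
Variable D : set (R * R).
Hypothesis mD : measurable (D : set (plane R)).

Lemma cmeasurableM (f g : R * R -> R[i]) :
  cmeasurable D f -> cmeasurable D g -> cmeasurable D (fun x => f x * g x).
Proof.
move=> [f1 f2] [g1 g2]; split.
  under eq_fun do rewrite ReM.
  by apply: measurable_funB; apply: measurable_funM.
under eq_fun do rewrite ImM.
by apply: measurable_funD; apply: measurable_funM.
Qed.

Lemma cmeasurable_cexpi (h : R * R -> R) :
  measurable_fun (D : set (plane R)) h -> cmeasurable D (fun x => cexpi (h x)).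
Proof.
move=> mh; split.
  apply: (@measurableT_comp _ _ _ _ _ _ (@cos R)) => //.
  by apply: continuous_measurable_fun; exact: continuous_cos.
apply: (@measurableT_comp _ _ _ _ _ _ (@sin R)) => //.
by apply: continuous_measurable_fun; exact: continuous_sin.
Qed.

Lemma measurable_cmod (f : R * R -> R[i]) :
  cmeasurable D f -> measurable_fun (D : set (plane R)) (fun x => cmod (f x)).
Proof.
move=> [f1 f2]; under eq_fun do rewrite cmodE.
apply: (@measurableT_comp _ _ _ _ _ _ (@Num.sqrt R)).
  by apply: continuous_measurable_fun; exact: sqrt_continuous.
by apply: measurable_funD; apply: measurable_funX.
Qed.

Lemma cintegrable_cmeasurable (f : R * R -> R[i]) : cintegrable D f -> cmeasurable D f.
Proof.
by move=> [/measurable_int/measurable_EFinP ? /measurable_int/measurable_EFinP ?].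
Qed.

Lemma cintegrableP (f : R * R -> R[i]) : cmeasurable D f ->
  (leb2 R).-integrable D (EFin \o (fun x => cmod (f x))) <-> cintegrable D f.
Proof.
move=> mf; have [f1 f2] := mf; split=> [fi|[i1 i2]].
  split; apply: le_integrable fi => //; try exact/measurable_EFinP.
    move=> x _; rewrite /= lee_fin (ger0_norm (cmod_ge0 _)); exact: Re_le_cmod.
  move=> x _; rewrite /= lee_fin (ger0_norm (cmod_ge0 _)); exact: Im_le_cmod.
have := integrableD mD (integrable_abse i1) (integrable_abse i2).
apply: le_integrable => //; first by apply/measurable_EFinP; exact: measurable_cmod.
move=> x _; rewrite /= lee_fin (ger0_norm (cmod_ge0 _)) (le_trans (cmod_le _))//.
exact: ler_norm.
Qed.

Lemma cintegrableM (f h : R * R -> R[i]) (M : R) :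
  cintegrable D f -> cmeasurable D h -> (forall x, D x -> cmod (h x) <= M) ->
  cintegrable D (fun x => f x * h x).
Proof.
move=> fi mh hM; have mf := cintegrable_cmeasurable fi.
apply/cintegrableP; first exact: cmeasurableM.
move/(cintegrableP mf) : fi => fi.
apply: (@le_integrable _ _ _ (leb2 R) _ mD _
  (fun x => M%:E * (EFin \o (fun x => cmod (f x))) x)%E).
- by apply/measurable_EFinP; apply: measurable_cmod; exact: cmeasurableM.
- move=> x Dx; rewrite /= lee_fin ger0_norm ?cmod_ge0// cmodM mulrC.
  by rewrite (le_trans _ (ler_norm _))// ler_wpM2r ?cmod_ge0 ?hM.
- exact: integrableZl.
Qed.

Lemma cmeasurable_cst (a : R[i]) : cmeasurable D (fun=> a).
Proof. by split; exact: measurable_cst. Qed.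

Lemma cintegrableZ (a : R[i]) (f : R * R -> R[i]) :
  cintegrable D f -> cintegrable D (fun x => a * f x).
Proof.
move=> fi; under eq_fun do rewrite mulrC.
apply: (cintegrableM fi) => [|x _]; [exact: cmeasurable_cst|exact: lexx].
Qed.

Lemma cintegralZ (a : R[i]) (f : R * R -> R[i]) : cintegrable D f ->
  cintegral D (fun x => a * f x) = a * cintegral D f.
Proof.
move=> [f1 f2].
have Z (c : R) (h : R * R -> R) : (leb2 R).-integrable D (EFin \o h) ->
  (leb2 R).-integrable D (EFin \o (fun x => c * h x)) by exact: integrableZl.
apply/eqP; rewrite eq_complex ReM ImM /=; apply/andP; split; apply/eqP.
  under eq_Rintegral do rewrite ReM.
  by rewrite RintegralB ?RintegralZl//; exact: Z.
under eq_Rintegral do rewrite ImM.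
by rewrite RintegralD ?RintegralZl//; exact: Z.
Qed.

Lemma cintegralD (f g : R * R -> R[i]) : cintegrable D f -> cintegrable D g ->
  cintegral D (fun x => f x + g x) = cintegral D f + cintegral D g.
Proof.
move=> [f1 f2] [g1 g2]; rewrite /cintegral; congr (_ +i* _)%C.
  rewrite -RintegralD//; apply: eq_Rintegral => x _.
  by case: (f x) => ? ?; case: (g x).
rewrite -RintegralD//; apply: eq_Rintegral => x _.
by case: (f x) => ? ?; case: (g x).
Qed.

(** With a = exp(-i alpha), a lower bound for the rotated real part of a pairing becomes a lower
    bound for an integral of moduli, which the maximal function controls. *)
Lemma Re_cintegralZ_le (a : R[i]) (f : R * R -> R[i]) :
  cintegrable D f -> cmod a <= 1 ->
  Re (a * cintegral D f) <= \int[leb2 R]_(x in D) cmod (f x).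
Proof.
move=> fi a1; rewrite -cintegralZ//=; apply: le_Rintegral => //.
- exact: (cintegrableZ a fi).1.
- by apply/cintegrableP => //; exact: cintegrable_cmeasurable.
- move=> x _; rewrite (le_trans (ler_norm _))// (le_trans (Re_le_cmod _))//.
  by rewrite cmodM ler_piMl ?cmod_ge0.
Qed.

End integration.
End complex_tools.

(** * Fubini and the multiplication formula *)

Section fourier.
Variable R : realType.
Local Notation Re := complex.Re.
Local Notation Im := complex.Im.
Local Notation m2 := (mu2 R).

Lemma measurable_sectionl (k : R * R -> R * R -> R) x :
  measurable_fun (setT : set (plane R * plane R)) (fun z => k z.1 z.2) ->
  measurable_fun (setT : set (plane R)) (k x).
Proof. by move/(@measurable_fun_pair2 _ _ _ (plane R) (plane R) _ _ x). Qed.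

Lemma measurable_sectionr (k : R * R -> R * R -> R) y :
  measurable_fun (setT : set (plane R * plane R)) (fun z => k z.1 z.2) ->
  measurable_fun (setT : set (plane R)) (k ^~ y).
Proof. by move/(@measurable_fun_pair1 _ _ _ (plane R) (plane R) _ _ y). Qed.

Section complex_Fubini.
Variables (a b : R * R -> R[i]) (e : R * R -> R * R -> R).
Hypotheses (ia : cintegrable setT a) (ib : cintegrable setT b).
Hypothesis me : measurable_fun (setT : set (plane R * plane R)) (fun z => e z.1 z.2).

Let K x y : R[i] := a x * b y * cexpi (e x y).

Let mT := @measurableT _ (plane R).

Let measurable_kernel :
  measurable_fun (setT : set (plane R * plane R)) (fun z => Re (K z.1 z.2)) /\
  measurable_fun (setT : set (plane R * plane R)) (fun z => Im (K z.1 z.2)).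
Proof.
have [a1 a2] := cintegrable_cmeasurable ia; have [b1 b2] := cintegrable_cmeasurable ib.
have mc : measurable_fun (setT : set (plane R * plane R)) (fun z => cos (e z.1 z.2)).
  apply: (@measurableT_comp _ _ _ _ _ _ (@cos R)) => //.
  by apply: continuous_measurable_fun; exact: continuous_cos.
have ms : measurable_fun (setT : set (plane R * plane R)) (fun z => sin (e z.1 z.2)).
  apply: (@measurableT_comp _ _ _ _ _ _ (@sin R)) => //.
  by apply: continuous_measurable_fun; exact: continuous_sin.
have f1 (f : R * R -> R) : measurable_fun (setT : set (plane R)) f ->
  measurable_fun (setT : set (plane R * plane R)) (fun z => f z.1).
  by move=> mf; apply: (measurableT_comp mf); exact: measurable_fst.
have f2 (f : R * R -> R) : measurable_fun (setT : set (plane R)) f ->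
  measurable_fun (setT : set (plane R * plane R)) (fun z => f z.2).
  by move=> mf; apply: (measurableT_comp mf); exact: measurable_snd.
have [a1' a2' b1' b2'] := And4 (f1 _ a1) (f1 _ a2) (f2 _ b1) (f2 _ b2).
split.
  under eq_fun do rewrite /K !(ReM, ImM) /=.
  by repeat (exact: mc || exact: ms || assumption || apply: measurable_funB ||
    apply: measurable_funD || apply: measurable_funM).
under eq_fun do rewrite /K !(ReM, ImM) /=.
by repeat (exact: mc || exact: ms || assumption || apply: measurable_funB ||
    apply: measurable_funD || apply: measurable_funM).
Qed.

Let cmod_kernel x y : cmod (K x y) = cmod (a x) * cmod (b y).
Proof. by rewrite /K !cmodM cmod_cexpi mulr1. Qed.

Let ia' : m2.-integrable setT (EFin \o (fun x => cmod (a x))).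
Proof. by apply/cintegrableP => //; exact: cintegrable_cmeasurable. Qed.

Let ib' : m2.-integrable setT (EFin \o (fun x => cmod (b x))).
Proof. by apply/cintegrableP => //; exact: cintegrable_cmeasurable. Qed.

(** The phase factor has modulus 1, so |K x y| = |a x| |b y|. This tensor product dominates real and
    imaginary parts alike and makes every section integrable. *)
Let integrable_kernel (k : R * R -> R * R -> R) :
  measurable_fun (setT : set (plane R * plane R)) (fun z => k z.1 z.2) ->
  (forall x y, `|k x y| <= cmod (K x y)) ->
  [/\ (m2 \x m2)%E.-integrable setT (fun z => (k z.1 z.2)%:E),
      forall x, m2.-integrable setT (EFin \o k x) &
      forall y, m2.-integrable setT (EFin \o (k ^~ y))].
Proof.
move=> mk kK; split.
- apply: le_integrable (integrable_tensor ia' ib') => //; first exact/measurable_EFinP.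
  by move=> z _; rewrite /= lee_fin (le_trans (kK _ _))// cmod_kernel ler_norm.
- move=> x; apply: (@le_integrable _ _ _ m2 _ mT _
      (fun y => (cmod (a x))%:E * (EFin \o (fun y => cmod (b y))) y)%E).
  + by apply/measurable_EFinP; exact: measurable_sectionl.
  + by move=> y _; rewrite /= lee_fin (le_trans (kK _ _))// cmod_kernel ler_norm.
  + exact: integrableZl.
- move=> y; apply: (@le_integrable _ _ _ m2 _ mT _
      (fun x => (cmod (b y))%:E * (EFin \o (fun x => cmod (a x))) x)%E).
  + by apply/measurable_EFinP; exact: measurable_sectionr.
  + by move=> x _; rewrite /= lee_fin (le_trans (kK _ _))// cmod_kernel mulrC ler_norm.
  + exact: integrableZl.
Qed.

Lemma cintegrable_inner :
  cintegrable setT (fun x => cintegral setT (fun y => a x * b y * cexpi (e x y))).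
Proof.
have [mR mI] := measurable_kernel.
have [] := integrable_kernel mR (fun x y => Re_le_cmod _) => i1 i2 _.
have [] := integrable_kernel mI (fun x y => Im_le_cmod _) => j1 j2 _.
split; first exact: (integrable_Rintegral i1 i2).
exact: (integrable_Rintegral j1 j2).
Qed.

Lemma complex_Fubini :
  cintegral setT (fun x => cintegral setT (fun y => a x * b y * cexpi (e x y))) =
  cintegral setT (fun y => cintegral setT (fun x => a x * b y * cexpi (e x y))).
Proof.
have [mR mI] := measurable_kernel.
have [] := integrable_kernel mR (fun x y => Re_le_cmod _) => i1 i2 i3.
have [] := integrable_kernel mI (fun x y => Im_le_cmod _) => j1 j2 j3.
have eR := Rintegral_Fubini i1 i2 i3.
have eI := Rintegral_Fubini j1 j2 j3.
rewrite [LHS]/cintegral [RHS]/cintegral.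
have P (u v w z : R) : u = w -> v = z -> (u +i* v)%C = (w +i* z)%C by move=> -> ->.
apply: P.
  exact: eR.
exact: eI.
Qed.

End complex_Fubini.

Lemma measurable_dot :
  measurable_fun (setT : set (plane R * plane R)) (fun z => dot z.1 z.2).
Proof.
have m1 : measurable_fun (setT : set (plane R)) fst by exact: measurable_fst.
have m2' : measurable_fun (setT : set (plane R)) snd by exact: measurable_snd.
have f1 : measurable_fun (setT : set (plane R * plane R)) fst by exact: measurable_fst.
have f2 : measurable_fun (setT : set (plane R * plane R)) snd by exact: measurable_snd.
by apply: measurable_funD; apply: measurable_funM;
  (apply: measurableT_comp f1 || apply: measurableT_comp f2).
Qed.

Lemma measurable_dotl (x : R * R) :
  measurable_fun (setT : set (plane R)) (fun y => dot x y).
Proof. exact: measurable_sectionl measurable_dot. Qed.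

Lemma dotC (x y : R * R) : dot x y = dot y x.
Proof. by rewrite /dot mulrC [y.2 * _]mulrC. Qed.

Lemma cintegrable_cexpi (a : R * R -> R[i]) (h : R * R -> R) :
  cintegrable setT a -> measurable_fun (setT : set (plane R)) h ->
  cintegrable setT (fun x => a x * cexpi (h x)).
Proof.
move=> ia mh; apply: (@cintegrableM _ _ measurableT _ _ 1) => //.
  exact: cmeasurable_cexpi.
by move=> x _; rewrite cmod_cexpi.
Qed.

(** Since distributions are transformed by duality, this identity is what makes the function
    [fourier g] the Fourier transform of [dist_of g]. *)
Lemma multiplication_formula (g phi : R * R -> R[i]) :
  cintegrable setT g -> cintegrable setT phi ->
  cintegral setT (fun x => g x * fourier phi x) =
  cintegral setT (fun xi => fourier g xi * phi xi).
Proof.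
move=> ig ip.
have md : measurable_fun (setT : set (plane R * plane R)) (fun z => - dot z.1 z.2).
  by apply: measurable_funN; exact: measurable_dot.
have mdl x : measurable_fun (setT : set (plane R)) (fun y => - dot y x).
  by under eq_fun do rewrite dotC; apply: measurable_funN; exact: measurable_dotl.
transitivity (cintegral setT (fun x => cintegral setT (fun y =>
    g x * phi y * cexpi (- dot x y)))).
  congr (cintegral setT _); apply/funext => x.
  rewrite /fourier -cintegralZ//; last exact: cintegrable_cexpi.
  by congr (cintegral setT _); apply/funext => y; rewrite mulrA dotC.
rewrite (complex_Fubini ig ip md).
congr (cintegral setT _); apply/funext => y.
rewrite mulrC /fourier -cintegralZ//; last exact: cintegrable_cexpi.
by congr (cintegral setT _); apply/funext => x; rewrite mulrA [phi y * _]mulrC.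
Qed.

End fourier.

(** * The data *)

Section sobolev_data.
Variable R : realType.
Local Notation Re := complex.Re.
Local Notation Im := complex.Im.
Local Notation mT := (@measurableT _ (plane R)).
Let mu : {sigma_finite_measure set (measurableTypeR R) -> \bar R} := @lebesgue_measure R.

Lemma schwartz_cmeasurable (phi : R * R -> R[i]) : schwartz phi -> cmeasurable setT phi.
Proof.
move=> [sr si _]; split; apply: continuous_measurable_plane => x;
  apply: differentiable_continuous; [exact: (sr 0 0 x)|exact: (si 0 0 x)].
Qed.

(** As (1 + |x|^2)^2 >= (1 + x1^2)(1 + x2^2), the seminorm of order 2 bounds the function by a
    tensor product of integrable weights on the line. *)
Lemma schwartz_cintegrable (phi : R * R -> R[i]) : schwartz phi -> cintegrable setT phi.
Proof.
move=> sphi; have [mr mi] := schwartz_cmeasurable sphi.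
have [_ _ /(_ 2) [M [Mr Mi]]] := sphi.
have dec (h : R * R -> R) : measurable_fun (setT : set (plane R)) h ->
    seminorm_le 2 M h -> (leb2 R).-integrable setT (EFin \o h).
  move=> mh hM; have iw := @integrable_oneDsqrV R.
  have := @integrable_scale _ _ _ (leb2 R) M _ (integrable_tensor (m1 := mu) (m2 := mu) iw iw).
  apply: le_integrable => //; first exact/measurable_EFinP.
  move=> x _; rewrite lee_fin (le_trans _ (ler_norm _))//.
  rewrite -invfM ler_pdivlMr; last by rewrite mulr_gt0// ltr_pwDl ?sqr_ge0.
  rewrite (le_trans _ (hM 0 0 x isT))// mulrC ler_wpM2r//.
  rewrite [leRHS]expr2 /sqnorm /dot -!expr2.
  have := sqr_ge0 x.1; have := sqr_ge0 x.2.
  set u := x.1 ^+ 2; set v := x.2 ^+ 2 => v0 u0.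
  by apply: ler_pM; rewrite ?addr_ge0//; lra.
by split; exact: dec.
Qed.

Lemma schwartz_bounded (phi : R * R -> R[i]) M : seminorm_le 0 M (fun x => Re (phi x)) ->
  seminorm_le 0 M (fun x => Im (phi x)) -> forall x, cmod (phi x) <= 2 * M.
Proof.
move=> Mr Mi x; have := Mr 0 0 x isT; have := Mi 0 0 x isT.
rewrite /= !expr0 !mul1r => h1 h2; rewrite (le_trans (cmod_le _))//.
by rewrite mulr_natl mulr2n lerD.
Qed.

Lemma cintegrable_schwartzM (f phi : R * R -> R[i]) :
  cintegrable setT f -> schwartz phi -> cintegrable setT (fun x => f x * phi x).
Proof.
move=> fi sphi; have [_ _ /(_ 0) [M [Mr Mi]]] := sphi.
apply: (@cintegrableM _ _ mT _ _ (2 * M)) => //; first exact: schwartz_cmeasurable.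
by move=> x _; apply: schwartz_bounded.
Qed.

Lemma tempered_dist_of (g : R * R -> R[i]) : cintegrable setT g -> tempered (dist_of g).
Proof.
move=> ig; split.
  move=> a phi psi sphi spsi; rewrite /dist_of.
  have i1 := cintegrable_schwartzM ig sphi; have i2 := cintegrable_schwartzM ig spsi.
  rewrite -cintegralZ// -cintegralD//; last exact: cintegrableZ.
  by congr (cintegral setT _); apply/funext => x; rewrite mulrDr mulrCA.
(* One factor 2 comes from [cmod (phi x) <= 2 * M], the other from estimating the real and imaginary
   parts of the integral separately. *)
exists (4 * \int[leb2 R]_x cmod (g x)), 0%N => phi M sphi Mr Mi.
have b := schwartz_bounded Mr Mi; have ip := cintegrable_schwartzM ig sphi.
have icg : (leb2 R).-integrable setT (EFin \o (fun x => cmod (g x))).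
  by apply/cintegrableP => //; exact: cintegrable_cmeasurable.
have icp : (leb2 R).-integrable setT (EFin \o (fun x => cmod (g x * phi x))).
  by apply/cintegrableP => //; exact: cintegrable_cmeasurable.
have H : \int[leb2 R]_x cmod (g x * phi x) <= 2 * M * \int[leb2 R]_x cmod (g x).
  rewrite -RintegralZl//; apply: le_Rintegral => //; first exact: integrable_scale.
  by move=> x _; rewrite cmodM mulrC ler_wpM2r ?cmod_ge0.
rewrite (le_trans (cmod_le _))// /dist_of /=.
have H1 : `|\int[leb2 R]_x Re (g x * phi x)| <= \int[leb2 R]_x cmod (g x * phi x).
  rewrite (le_trans (le_normr_Rintegral _ ip.1))//.
  apply: le_Rintegral => //; first exact: integrable_norm ip.1.
  by move=> x _; exact: Re_le_cmod.
have H2 : `|\int[leb2 R]_x Im (g x * phi x)| <= \int[leb2 R]_x cmod (g x * phi x).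
  rewrite (le_trans (le_normr_Rintegral _ ip.2))//.
  apply: le_Rintegral => //; first exact: integrable_norm ip.2.
  by move=> x _; exact: Im_le_cmod.
rewrite (le_trans (lerD H1 H2))// (le_trans (lerD H H))//.
by rewrite (_ : 2 * M * _ + _ = 4 * (\int[leb2 R]_x cmod (g x)) * M)//; ring.
Qed.

Lemma in_sobolev_dist_of (s : R) (g fhat : R * R -> R[i]) (B : R) :
  cintegrable setT g -> cmeasurable setT fhat -> (forall xi, cmod (fhat xi) <= B) ->
  fourier g =1 fhat -> (sobolev_norm s fhat < +oo)%E ->
  in_sobolev s (dist_of g) fhat.
Proof.
move=> ig mf fB gf sf; split => //; first exact: tempered_dist_of.
split => // phi sphi; have ip := schwartz_cintegrable sphi; split.
  under eq_fun do rewrite mulrC.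
  exact: (@cintegrableM _ _ mT _ _ B).
rewrite /dist_fourier /dist_of multiplication_formula//.
by congr (cintegral setT _); apply/funext => x; rewrite gf.
Qed.

Definition datum (xi0 : R * R) (a b : R) (x : R * R) : R[i] :=
  cexpi (dot x xi0) * real_complex R (fejer a x.1 * fejer b x.2).

Definition datum_hat (xi0 : R * R) (a b : R) (xi : R * R) : R :=
  fejer_mass R ^+ 2 * (tent a (xi.1 - xi0.1) * tent b (xi.2 - xi0.2)).

Lemma cintegrable_datum (xi0 : R * R) (a b : R) : cintegrable setT (datum xi0 a b).
Proof.
apply: (@eq_ind _ (fun x => real_complex R (fejer a x.1 * fejer b x.2) * cexpi (dot x xi0))
  (cintegrable setT)); last by apply/funext => x; rewrite mulrC.
apply: cintegrable_cexpi.
  split => /=; first exact: (integrable_tensor (m1 := mu) (m2 := mu)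
    (integrable_fejer a) (integrable_fejer b)).
  exact: integrable0.
by under eq_fun do rewrite dotC; exact: measurable_dotl.
Qed.

Lemma fourier_datum (xi0 : R * R) (a b : R) : 0 <= a -> 0 <= b ->
  fourier (datum xi0 a b) =1 real_complex R \o datum_hat xi0 a b.
Proof.
move=> a0 b0 xi; pose e1 := xi0.1 - xi.1; pose e2 := xi0.2 - xi.2.
(* The exponential is written in products of functions of one variable. The Fejer kernel is even, so
   every product containing a sine integrates to 0 and only the one with two cosines survives. *)
have E x : datum xi0 a b x * cexpi (- dot x xi) =
  (((fejer a x.1 * cos (x.1 * e1)) * (fejer b x.2 * cos (x.2 * e2))
   - (fejer a x.1 * sin (x.1 * e1)) * (fejer b x.2 * sin (x.2 * e2)))
   +i* ((fejer a x.1 * sin (x.1 * e1)) * (fejer b x.2 * cos (x.2 * e2))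
   + (fejer a x.1 * cos (x.1 * e1)) * (fejer b x.2 * sin (x.2 * e2))))%C.
  rewrite /datum mulrAC -cexpiD mulrC.
  have -> : dot x xi0 + - dot x xi = x.1 * e1 + x.2 * e2.
    by rewrite /dot /e1 /e2; ring.
  by apply/eqP; rewrite eq_complex ReM ImM !Re_cexpi !Im_cexpi /= cosD sinD;
    apply/andP; split; apply/eqP; ring.
have T (u v : R -> R) : mu.-integrable setT (EFin \o u) -> mu.-integrable setT (EFin \o v) ->
    (leb2 R).-integrable setT (EFin \o (fun x => u x.1 * v x.2)).
  by move=> iu iv; exact: (integrable_tensor (m1 := mu) (m2 := mu) iu iv).
have J (u v : R -> R) : mu.-integrable setT (EFin \o u) -> mu.-integrable setT (EFin \o v) ->
    \int[leb2 R]_x (u x.1 * v x.2) = (\int[mu]_x u x) * (\int[mu]_x v x).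
  by move=> iu iv; exact: (Rintegral_tensor (m1 := mu) (m2 := mu) iu iv).
have [ca sa] := (integrable_fejer_cos a e1, integrable_fejer_sin a e1).
have [cb sb] := (integrable_fejer_cos b e2, integrable_fejer_sin b e2).
rewrite /fourier /cintegral; under eq_Rintegral do rewrite E.
under [X in (_ +i* X)%C]eq_Rintegral do rewrite E.
have tN (c y z : R) : tent c (y - z) = tent c (z - y) by rewrite /tent distrC.
apply/eqP; rewrite eq_complex /=; apply/andP; split; apply/eqP.
  rewrite RintegralB//; [|exact: T _ _ ca cb|exact: T _ _ sa sb].
  rewrite (J _ _ ca cb) (J _ _ sa sb) !Rintegral_fejer_cos// !Rintegral_fejer_sin.
  by rewrite mul0r subr0 /datum_hat (tN a) (tN b) /e1 /e2; ring.
rewrite RintegralD//; [|exact: T _ _ sa cb|exact: T _ _ ca sb].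
by rewrite (J _ _ sa cb) (J _ _ ca sb) !Rintegral_fejer_sin mul0r mulr0 addr0.
Qed.

End sobolev_data.

(** * Smooth test functions *)

Section smooth_line.
Variable R : realType.
Implicit Types f g : R -> R.

(** With an existentially quantified derivative, closure under sums, products and affine
    substitutions follows by induction on n, without formulas for iterated derivatives;
    [smooth1_derive] returns to [derive1]. *)
Fixpoint diffn (n : nat) (f : R -> R) : Prop :=
  if n is n'.+1 then
    exists2 g : R -> R, (forall x : R, is_derive x 1 f (g x)) & diffn n' g
  else True.

Definition smooth1 f := forall n, diffn n f.

Lemma diffnW n f : diffn n.+1 f -> diffn n f.
Proof.
elim: n f => [//|n IH] f [g fg dg]; exists g => //; exact: IH.
Qed.

Lemma diffnD n f g : diffn n f -> diffn n g -> diffn n (fun x => f x + g x).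
Proof.
elim: n f g => [//|n IH] f g [f' df nf] [g' dg ng].
by exists (fun x => f' x + g' x); [move=> x; exact: is_deriveD|exact: IH].
Qed.

Lemma diffnM n f g : diffn n f -> diffn n g -> diffn n (fun x => f x * g x).
Proof.
elim: n f g => [//|n IH] f g df dg.
have [f' df' nf] := df; have [g' dg' ng] := dg.
exists (fun x => f x * g' x + g x * f' x).
  by move=> x; exact: is_deriveM.
by apply: diffnD; apply: IH => //; exact: diffnW.
Qed.

Lemma diffn_cst n (c : R) : diffn n (fun=> c).
Proof.
by elim: n c => [//|n IH] c; exists (fun=> 0); [move=> x; exact: is_derive_cst|exact: IH].
Qed.

Lemma diffn_affine n f (c d : R) : diffn n f -> diffn n (fun x => f (c * x + d)).
Proof.
elim: n f => [//|n IH] f [f' df nf].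
exists (fun x => c * f' (c * x + d)); last by apply: diffnM; [exact: diffn_cst|exact: IH].
move=> x; have dc : is_derive x 1 (fun x : R => c * x + d) c.
  by apply: is_derive_eq; rewrite addr0 [LHS]mulr1.
by rewrite mulrC; exact: is_derive1_comp.
Qed.

(** Cosine and sine are treated together because their combinations of frequency c are closed under
    differentiation, which makes the induction go through. *)
Lemma diffn_trig n (a b c : R) : diffn n (fun x => a * cos (c * x) + b * sin (c * x)).
Proof.
elim: n a b => [//|n IH] a b.
exists (fun x => (b * c) * cos (c * x) + (- a * c) * sin (c * x)); last exact: IH.
move=> x; have dc : is_derive x 1 (fun x : R => c * x) c.
  by apply: is_derive_eq; rewrite [LHS]mulr1.
by apply: is_derive_eq; rewrite /GRing.scale/=; ring.
Qed.

Lemma smooth1M f g : smooth1 f -> smooth1 g -> smooth1 (fun x => f x * g x).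
Proof. by move=> sf sg n; exact: diffnM. Qed.

Lemma smooth1_cos (c : R) : smooth1 (fun x => cos (c * x)).
Proof.
move=> n; have := diffn_trig n 1 0 c; congr (diffn n _); apply/funext => x.
by rewrite mul1r mul0r addr0.
Qed.

Lemma smooth1_sin (c : R) : smooth1 (fun x => sin (c * x)).
Proof.
move=> n; have := diffn_trig n 0 1 c; congr (diffn n _); apply/funext => x.
by rewrite mul1r mul0r add0r.
Qed.

Lemma smooth1_derive f : smooth1 f ->
  (forall x : R, is_derive x 1 f ((derive1 f) x)) /\ smooth1 (derive1 f).
Proof.
move=> sf; have D (g : R -> R) (x : R) : is_derive x 1 f (g x) -> (derive1 f) x = g x.
  by move=> ?; rewrite derive1E derive_val.
split=> [x|n]; first by have [g dg _] := sf 1%N; rewrite (D g).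
have [g dg ng] := sf n.+1; rewrite (_ : (derive1 f) = g)//.
by apply/funext => x; exact: D.
Qed.

(** The classical flat function exp(-1/y), with a polynomial factor in 1/y. Differentiation replaces
    p by X^2 (p - p'), so the family is stable and its members are smooth all at once. *)
Definition flat (p : {poly R}) (y : R) : R :=
  if 0 < y then p.[y^-1] * expR (- y^-1) else 0.

Lemma poly_expR_bounded (p : {poly R}) :
  exists2 C, 0 <= C & forall u, 0 < u -> `|p.[u] * expR (- u)| <= C.
Proof.
exists (\sum_(i < size p) `|p`_i| * (i`!)%:R).
  by apply: sumr_ge0 => i _; rewrite mulr_ge0.
move=> u u0; rewrite horner_coef mulr_suml (le_trans (ler_norm_sum _ _ _))//.
apply: ler_sum => i _; rewrite !normrM -mulrA ler_wpM2l//.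
rewrite (ger0_norm (expR_ge0 _)) ger0_norm ?exprn_ge0 ?(ltW u0)//.
have ge : u ^+ i / i`!%:R <= expR u.
  case: i => [[|i] /= _]; last first.
    by rewrite (le_trans _ (expR_ge1Dxn i (ltW u0)))// lerDr.
  by rewrite expr0 fact0 divr1 (le_trans _ (expR_ge1Dx u))// lerDl ltW.
by rewrite expRN ler_pdivrMr ?expR_gt0// mulrC -ler_pdivrMr// ltr0n fact_gt0.
Qed.

End smooth_line.

Section bump.
Variable R : realType.

Lemma is_derive_flat_pos (p : {poly R}) (x : R) : 0 < x ->
  is_derive x 1 (flat p) (flat ('X^2 * (p - p^`()%R)) x).
Proof.
move=> x0; have x0' : x != 0 by rewrite gt_eqF.
apply: (@near_eq_is_derive _ _ _ (fun y : R => p.[y^-1] * expR (- y^-1))).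
  by near=> y; rewrite /flat ifT//; near: y; exact: lt_nbhsr.
have dV : is_derive x 1 (fun y : R => y^-1) (- x ^- 2).
  have := @is_deriveV R id x 1 1 x0' (is_derive_id x 1).
  by rewrite [_ *: _]mulr1.
have dp : is_derive x 1 (fun y : R => p.[y^-1]) (p^`().[x^-1] * - x ^- 2).
  exact: (@is_derive1_comp _ (horner p) _ _ _ _ (is_derive_poly p _) dV).
have de : is_derive x 1 (fun y : R => expR (- y^-1)) (expR (- x^-1) * x ^- 2).
  have dN : is_derive x 1 (fun y : R => - y^-1) (x ^- 2).
    by apply: is_derive_eq; rewrite opprK.
  exact: (@is_derive1_comp _ expR _ _ _ _ (is_derive_expR _) dN).
apply: is_derive_eq; rewrite /flat x0 /GRing.scale/= hornerM hornerXn hornerD hornerN.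
rewrite exprVn; ring.
Unshelve. all: by end_near. Qed.

(** The function u^2 p(u) exp(-u) is bounded for u > 0; taking u = 1/h gives the factor h^2, which
    makes the derivative at 0 exist and vanish. *)
Lemma flat_le (p : {poly R}) : exists2 C, 0 <= C & forall h, `|flat p h| <= C * h ^+ 2.
Proof.
have [C C0 hC] := poly_expR_bounded ('X^2 * p); exists C => // h.
rewrite /flat; case: ifPn => h0; last by rewrite normr0 mulr_ge0 ?sqr_ge0.
have := hC h^-1; rewrite invr_gt0 => /(_ h0); rewrite hornerM hornerXn.
have h20 : 0 < h ^+ 2 by rewrite exprn_gt0.
rewrite -mulrA normrM exprVn [X in X * _]ger0_norm ?invr_ge0 ?sqr_ge0//.
by rewrite ler_pdivrMl// [leRHS]mulrC.
Qed.

Lemma is_derive_flat (p : {poly R}) (x : R) :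
  is_derive x 1 (flat p) (flat ('X^2 * (p - p^`()%R)) x).
Proof.
have [x0|x0|->] := ltrgtP x 0; last 1 first.
- rewrite {2}/flat ltxx.
  suff H : (fun h : R => h^-1 *: ((flat p \o shift 0) (h *: 1) - flat p 0)) @ 0^' --> (0 : R).
    by apply: DeriveDef; [apply/cvg_ex; exists 0|exact: cvg_lim].
  have [C C0 hC] := flat_le p.
  apply/cvgr0Pnorm_lt => e e0; have eC : 0 < e / (C + 1) by rewrite divr_gt0// ltr_wpDl.
  near=> h; rewrite /= addr0 [h *: 1]mulr1 {2}/flat ltxx subr0 normrM normfV.
  have h0 : 0 < `|h| by rewrite normr_gt0; near: h; exact: nbhs_dnbhs_neq.
  rewrite ltr_pdivrMl// (le_lt_trans (hC h))// -real_normK ?num_real// expr2 mulrA.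
  rewrite [ltRHS]mulrC ltr_pM2r//.
  have : `|h| < e / (C + 1).
    by near: h; apply: dnbhs0_lt.
  rewrite ltr_pdivlMr ?ltr_wpDl// mulrDr mulr1 mulrC; apply: le_lt_trans.
  by rewrite lerDl.
- rewrite (_ : flat ('X^2 * _) x = 0); last by rewrite /flat ltNge (ltW x0).
  apply: (@near_eq_is_derive _ _ _ (cst (0 : R))).
  near=> y; rewrite /flat ifF//; apply/negbTE; rewrite -leNgt; apply: ltW.
  by near: y; exact: lt_nbhsl.
- exact: is_derive_flat_pos.
Unshelve. all: by end_near. Qed.

Lemma smooth1_flat (p : {poly R}) : smooth1 (flat p).
Proof.
move=> n; elim: n p => [//|n IH] p.
by exists (flat ('X^2 * (p - p^`()%R))) => // x; exact: is_derive_flat.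
Qed.

(** Inside (-1, 1) this is exp(-2 / (1 - x^2)). The arguments are spelled as affine maps to match
    [diffn_affine]. *)
Definition bump (x : R) : R := flat 1 (1 * x + 1) * flat 1 (- 1 * x + 1).

Lemma smooth1_bump (c d : R) : smooth1 (fun x => bump (c * x + d)).
Proof.
move=> n; apply: (@diffn_affine _ _ bump).
by apply: diffnM; apply: diffn_affine; exact: smooth1_flat.
Qed.

Lemma flat1_ge0 y : 0 <= flat (1 : {poly R}) y.
Proof. by rewrite /flat; case: ifP => // _; rewrite hornerC mul1r expR_ge0. Qed.

Lemma flat1_le1 y : flat (1 : {poly R}) y <= 1.
Proof.
rewrite /flat; case: ifP => // y0; rewrite hornerC mul1r -expR0 ler_expR.
by rewrite oppr_le0 invr_ge0 ltW.
Qed.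

Lemma flat1_eq0 y : y <= 0 -> flat (1 : {poly R}) y = 0.
Proof. by rewrite /flat leNgt => /negbTE ->. Qed.

Lemma bump_ge0 x : 0 <= bump x.
Proof. by rewrite mulr_ge0 ?flat1_ge0. Qed.

Lemma bump_le1 x : bump x <= 1.
Proof. by rewrite mulr_ile1 ?flat1_ge0 ?flat1_le1. Qed.

Lemma bump_eq0 x : 1 <= `|x| -> bump x = 0.
Proof.
rewrite /bump mul1r mulN1r ler_normr => /orP[x1|x1].
  by rewrite [flat _ (- x + 1)]flat1_eq0 ?mulr0//; lra.
by rewrite flat1_eq0 ?mul0r//; lra.
Qed.

Lemma bump_ge x : `|x| <= 2^-1 -> expR (- 4) <= bump x.
Proof.
rewrite ler_norml => /andP[x1 x2].
have H y : 2^-1 <= y -> expR (- 2) <= flat (1 : {poly R}) y.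
  move=> y2; have y0 : 0 < y by rewrite (lt_le_trans _ y2)// invr_gt0.
  rewrite /flat y0 hornerC mul1r ler_expR lerN2 -[leRHS]invrK lef_pV2 ?posrE ?invr_gt0//.
rewrite (_ : - 4 = - 2 + - 2); last by lra.
by rewrite expRD ler_pM ?expR_ge0// H//; lra.
Qed.

End bump.

Section test_functions.
Variable R : realType.
Local Notation Re := complex.Re.
Local Notation Im := complex.Im.
Local Notation d1 n := (iter n (@derive1 R R)).

(** The strict inequality describes an open set, so the property passes to derivatives. *)
Definition supported1 (f : R -> R) := forall u, 1 < `|u| -> f u = 0.

Lemma smooth1_iter (f : R -> R) n : smooth1 f -> smooth1 (d1 n f).
Proof. by move=> sf; elim: n => //= n IH; exact: (smooth1_derive IH).2. Qed.

Lemma smooth1_is_derive (f : R -> R) n (x : R) : smooth1 f -> is_derive x 1 (d1 n f) (d1 n.+1 f x).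
Proof. by move=> sf; exact: (smooth1_derive (smooth1_iter n sf)).1. Qed.

Lemma supported1_iter (f : R -> R) n : supported1 f -> supported1 (d1 n f).
Proof.
move=> sf; elim: n => //= n IH u u1; rewrite derive1E.
rewrite -[RHS](@derive_cst _ R R (0 : R) u 1); apply: near_eq_derive.
move: u1; rewrite lter_normr => /orP[u1|u1]; near=> y; apply: IH; rewrite lter_normr.
  by apply/orP; left; near: y; exact: lt_nbhsr.
apply/orP; right; rewrite ltrNr; near: y; apply: lt_nbhsl.
by rewrite ltrNr.
Unshelve. all: by end_near. Qed.

Lemma smooth1_bounded (f : R -> R) : smooth1 f -> supported1 f ->
  exists2 M, 0 <= M & forall u, `|f u| <= M.
Proof.
move=> sf f0; have cf : continuous (fun u => `|f u|).
  move=> u; apply: (continuous_comp (f := f)); last exact: norm_continuous.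
  apply/differentiable_continuous/derivable1_diffP.
  by have [] := smooth1_is_derive 0 u sf.
have [|c _ hc] := @EVT_max R (fun u => `|f u|) (- 1) 1 _ (continuous_subspaceT cf).
  by lra.
exists `|f c| => // u; have [u1|u1] := leP `|u| 1.
  by apply: hc; rewrite in_itv/= -ler_norml.
by rewrite f0// normr0.
Qed.

(** By the addition formulas, real and imaginary parts of a modulated product of two functions have
    this shape, and partial derivatives act on its factors separately. *)
Definition tensor2 (A B C D : R -> R) (x : R * R) : R := A x.1 * B x.2 + C x.1 * D x.2.

Lemma derive_fst (h : R * R -> R) (x : R * R) :
  'D_((1, 0) : R * R) h x = derive1 (fun u => h (u, x.2)) x.1.
Proof.
rewrite derive1E /derive.
have -> // : (fun t : R => t^-1 *: ((h \o shift x) (t *: ((1, 0) : R * R)) - h x)) =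
    (fun t : R => t^-1 *: (((fun u : R => h (u, x.2)) \o shift x.1) (t *: (1 : R))
                           - h (x.1, x.2))).
apply/funext => t /=; have -> : t *: ((1, 0) : R * R) + x = (t *: (1 : R) + x.1, x.2).
  by case: x => x y /=; congr (_, _); rewrite /= [X in X + _]mulr0 add0r.
by case: x.
Qed.

Lemma derive_snd (h : R * R -> R) (x : R * R) :
  'D_((0, 1) : R * R) h x = derive1 (fun u => h (x.1, u)) x.2.
Proof.
rewrite derive1E /derive.
have -> // : (fun t : R => t^-1 *: ((h \o shift x) (t *: ((0, 1) : R * R)) - h x)) =
    (fun t : R => t^-1 *: (((fun u : R => h (x.1, u)) \o shift x.2) (t *: (1 : R))
                           - h (x.1, x.2))).
apply/funext => t /=; have -> : t *: ((0, 1) : R * R) + x = (x.1, t *: (1 : R) + x.2).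
  by case: x => x y /=; congr (_, _); rewrite /= [X in X + _]mulr0 add0r.
by case: x.
Qed.

Section tensor2.
Variables A B C D : R -> R.
Hypotheses (sA : smooth1 A) (sB : smooth1 B) (sC : smooth1 C) (sD : smooth1 D).

Lemma partial_tensor2 a b : partial a b (tensor2 A B C D) =
  tensor2 (d1 a A) (d1 b B) (d1 a C) (d1 b D).
Proof.
rewrite /partial; have -> : iter b (fun g x => 'D_((0, 1) : R * R) g x) (tensor2 A B C D) =
    tensor2 A (d1 b B) C (d1 b D).
  elim: b => //= b ->; apply/funext => x; rewrite derive_snd derive1E /tensor2 /=.
  have hB := smooth1_is_derive b x.2 sB; have hD := smooth1_is_derive b x.2 sD.
  by rewrite derive_val.
elim: a => //= a ->; apply/funext => x; rewrite derive_fst derive1E /tensor2 /=.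
have hA := smooth1_is_derive a x.1 sA; have hC := smooth1_is_derive a x.1 sC.
rewrite derive_val /GRing.scale/= !mulr0 !add0r; congr (_ + _); exact: mulrC.
Qed.

End tensor2.

Lemma differentiable_tensor2 (A B C D : R -> R) (x : R * R) :
  smooth1 A -> smooth1 B -> smooth1 C -> smooth1 D ->
  differentiable (tensor2 A B C D) x.
Proof.
move=> sA sB sC sD.
have df (f : R -> R) (u : R) : smooth1 f -> differentiable f u.
  move=> sf; apply/derivable1_diffP; have [] := smooth1_is_derive 0 u sf; done.
have l_fst : differentiable (fst : R * R -> R) x.
  by apply: (linear_differentiable (f := (fst : {linear (R * R)%type -> R}))) => z; exact: cvg_fst.
have l_snd : differentiable (snd : R * R -> R) x.
  by apply: (linear_differentiable (f := (snd : {linear (R * R)%type -> R}))) => z; exact: cvg_snd.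
have d_fst (f : R -> R) : smooth1 f -> differentiable (fun x : R * R => f x.1) x.
  by move=> sf; apply: (@differentiable_comp _ _ _ _ fst f) => //; exact: df.
have d_snd (f : R -> R) : smooth1 f -> differentiable (fun x : R * R => f x.2) x.
  by move=> sf; apply: (@differentiable_comp _ _ _ _ snd f) => //; exact: df.
by apply: differentiableD; apply: differentiableM; (exact: d_fst || exact: d_snd).
Qed.

Lemma smooth_tensor2 (A B C D : R -> R) :
  smooth1 A -> smooth1 B -> smooth1 C -> smooth1 D -> smooth (tensor2 A B C D).
Proof.
move=> sA sB sC sD a b x; rewrite partial_tensor2//.
by apply: differentiable_tensor2; exact: smooth1_iter.
Qed.

Lemma seminorm_tensor2 (A B C D : R -> R) N :
  smooth1 A -> smooth1 B -> smooth1 C -> smooth1 D ->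
  supported1 A -> supported1 B -> supported1 C -> supported1 D ->
  exists M, seminorm_le N M (tensor2 A B C D).
Proof.
move=> sA sB sC sD A0 B0 C0 D0.
have bd f : smooth1 f -> supported1 f ->
    {M : nat -> R | forall n, 0 <= M n & forall n u, `|d1 n f u| <= M n}.
  move=> sf f0; apply: cid2.
  have H n : exists M, 0 <= M /\ forall u, `|d1 n f u| <= M.
    have [M M0 hM] := smooth1_bounded (smooth1_iter n sf) (supported1_iter n f0).
    by exists M.
  by exists (fun n => sval (cid (H n))) => n; case: (svalP (cid (H n))).
have [MA MA0 hA] := bd A sA A0; have [MB MB0 hB] := bd B sB B0.
have [MC MC0 hC] := bd C sC C0; have [MD MD0 hD] := bd D sD D0.
(* On the square containing the support, 1 + |x|^2 <= 3. The double sum stands in for the maximum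
   over all orders a, b <= N. *)
exists (3 ^+ N * \sum_(a < N.+1) \sum_(b < N.+1) (MA a * MB b + MC a * MD b)).
move=> a b x abN; rewrite partial_tensor2//.
have [x1|x1] := boolP ((`|x.1| <= 1) && (`|x.2| <= 1)); last first.
  rewrite (_ : tensor2 _ _ _ _ x = 0).
    rewrite normr0 mulr0 mulr_ge0// ?exprn_ge0//.
    by do 2 (apply: sumr_ge0 => ? _); rewrite addr_ge0// mulr_ge0.
  rewrite /tensor2; move: x1; rewrite negb_and -!ltNge => /orP[x1|x1].
    by rewrite !(supported1_iter _ _ x1)// !mul0r addr0.
  by rewrite !(supported1_iter _ _ x1)// !mulr0 addr0.
have /andP[x11 x21] := x1; apply: ler_pM => //.
- by rewrite exprn_ge0// addr_ge0// /sqnorm /dot addr_ge0// -expr2 sqr_ge0.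
- rewrite lerXn2r// ?nnegrE//.
    by rewrite addr_ge0// /sqnorm /dot addr_ge0// -expr2 sqr_ge0.
  have sq (u : R) : `|u| <= 1 -> u ^+ 2 <= 1.
    by move=> u1; rewrite -real_normK ?num_real// exprn_ile1.
  have := sq _ x11; have := sq _ x21; rewrite /sqnorm /dot -!expr2; lra.
- have aN : (a < N.+1)%N by lia. have bN : (b < N.+1)%N by lia.
  rewrite (bigD1 (Ordinal aN))//= (bigD1 (Ordinal bN))//= -addrA.
  rewrite (le_trans (ler_normD _ _))// !normrM -[leLHS]addr0 lerD//.
    by rewrite lerD// ler_pM.
  rewrite addr_ge0//; first by apply: sumr_ge0 => ? _; rewrite addr_ge0// mulr_ge0.
  by do 2 (apply: sumr_ge0 => ? _); rewrite addr_ge0// mulr_ge0.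
Qed.

(** The modulation cancels the carrier frequency of the datum: in a pairing only the difference xi -
    xi0 remains in the spatial phase. *)
Definition packet (f g : R -> R) (xi0 x : R * R) : R[i] :=
  real_complex R (f x.1 * g x.2) * cexpi (- dot x xi0).

Lemma schwartz_packet (f g : R -> R) (xi0 : R * R) :
  smooth1 f -> smooth1 g -> supported1 f -> supported1 g -> schwartz (packet f g xi0).
Proof.
move=> sf sg f0 g0.
pose c (h : R -> R) q u := h u * cos (q * u).
pose s (h : R -> R) q u := h u * sin (q * u).
pose n (h : R -> R) u := h u * (-1).
have sc h q : smooth1 h -> smooth1 (c h q).
  by move=> sh; apply: smooth1M => //; exact: smooth1_cos.
have ss h q : smooth1 h -> smooth1 (s h q).
  by move=> sh; apply: smooth1M => //; exact: smooth1_sin.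
have sn h : smooth1 h -> smooth1 (n h).
  by move=> sh; apply: smooth1M => // m; exact: diffn_cst.
have zc h q : supported1 h -> supported1 (c h q).
  by move=> h0 u /h0; rewrite /c => ->; rewrite mul0r.
have zs h q : supported1 h -> supported1 (s h q).
  by move=> h0 u /h0; rewrite /s => ->; rewrite mul0r.
have zn h : supported1 h -> supported1 (n h) by move=> h0 u /h0; rewrite /n => ->; rewrite mul0r.
have reE : (fun x => Re (packet f g xi0 x)) =
    tensor2 (c f xi0.1) (c g xi0.2) (n (s f xi0.1)) (s g xi0.2).
  apply/funext => x; rewrite ReM Re_cexpi Im_cexpi cosN /tensor2 /c /s /n /= /dot cosD.
  by rewrite (mulrC xi0.1) (mulrC xi0.2); ring.
have imE : (fun x => Im (packet f g xi0 x)) =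
    tensor2 (n (s f xi0.1)) (c g xi0.2) (n (c f xi0.1)) (s g xi0.2).
  apply/funext => x; rewrite ImM Re_cexpi Im_cexpi sinN /tensor2 /c /s /n /= /dot sinD.
  by rewrite (mulrC xi0.1) (mulrC xi0.2); ring.
rewrite /schwartz reE imE; split.
- by apply: smooth_tensor2; auto.
- by apply: smooth_tensor2; auto.
move=> N.
have [M1 h1] : exists M, seminorm_le N M
    (tensor2 (c f xi0.1) (c g xi0.2) (n (s f xi0.1)) (s g xi0.2)).
  by apply: seminorm_tensor2; auto.
have [M2 h2] : exists M, seminorm_le N M
    (tensor2 (n (s f xi0.1)) (c g xi0.2) (n (c f xi0.1)) (s g xi0.2)).
  by apply: seminorm_tensor2; auto.
exists (Num.max M1 M2); split=> a b x abN.
  by rewrite le_max (h1 a b x abN).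
by rewrite le_max (h2 a b x abN) orbT.
Qed.

End test_functions.

(** * Lower bounds for the maximal function *)

Section lower_bound.
Variable R : realType.
Local Notation Re := complex.Re.
Local Notation mT := (@measurableT _ (plane R)).

Lemma measurable_eval2 (P : mpoly.mpoly 2 R) :
  measurable_fun (setT : set (plane R)) (eval2 P).
Proof.
have m1 : measurable_fun (setT : set (plane R)) (fst : R * R -> R) by exact: measurable_fst.
have m2 : measurable_fun (setT : set (plane R)) (snd : R * R -> R) by exact: measurable_snd.
rewrite (_ : eval2 P = fun x : R * R =>
    \sum_(mm <- msupp P) mcoeff mm P * (x.1 ^+ mm ord0 * x.2 ^+ mm ord_max)).
  apply: measurable_sum => mm; apply: measurable_funM; first exact: measurable_cst.
  by apply: measurable_funM; apply: measurable_funX.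
by apply/funext => -[a b]; exact: eval2E.
Qed.

Lemma Re_realM (a : R) (z : R[i]) : Re (real_complex R a * z) = a * Re z.
Proof. by rewrite ReM mul0r subr0. Qed.

Lemma cmod_packet (f g : R -> R) xi0 x : 0 <= f x.1 -> 0 <= g x.2 ->
  cmod (packet f g xi0 x) = f x.1 * g x.2.
Proof. by move=> f0 g0; rewrite /packet cmodM cmod_cexpi mulr1 cmod_real ger0_norm// mulr_ge0. Qed.

(** The pairing is a double integral of the nonnegative function F(xi) f(x.1) g(x.2) against a
    unimodular exponential whose phase stays within 1 of alpha wherever that function is nonzero.
    After rotation by alpha the real part of the exponential is a cosine of at least 1/2, which is
    the source of the division by 2. *)
Lemma propagator_packet_ge (P : mpoly.mpoly 2 R) (t alpha : R) (F : R * R -> R)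
    (f g : R -> R) (xi0 : R * R) :
  (leb2 R).-integrable setT (EFin \o F) -> (forall xi, 0 <= F xi) ->
  smooth1 f -> smooth1 g -> supported1 f -> supported1 g ->
  (forall u, 0 <= f u) -> (forall u, 0 <= g u) ->
  (forall xi x, F xi != 0 -> f x.1 * g x.2 != 0 ->
     `|eval2 P xi * t + dot x (xi.1 - xi0.1, xi.2 - xi0.2) - alpha| <= 1) ->
  (2 * pi) ^- 2 / 2 * (\int[leb2 R]_x (f x.1 * g x.2)) * (\int[leb2 R]_xi F xi) <=
  Re (cexpi (- alpha) * propagator P t (real_complex R \o F) (packet f g xi0)).
Proof.
move=> iF F0 sf sg f1 g1 f0 g0 phase.
have ip : cintegrable setT (packet f g xi0).
  by apply: schwartz_cintegrable; exact: schwartz_packet.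
have iFc : cintegrable setT (real_complex R \o F) by split => //; exact: integrable0.
have ichi : (leb2 R).-integrable setT (EFin \o (fun x => f x.1 * g x.2)).
  have := proj2 (cintegrableP mT (cintegrable_cmeasurable ip)) ip.
  by apply: eq_integrable => // x _; rewrite /comp cmod_packet.
pose I xi := cintegral setT (fun x =>
  (real_complex R \o F) xi * packet f g xi0 x * cexpi (dot xi x)).
have iI : cintegrable setT I by exact: (cintegrable_inner iFc ip (@measurable_dot R)).
pose c0 : R[i] := real_complex R ((2 * pi) ^- 2).
have c00 : 0 <= (2 * pi : R) ^- 2 by rewrite invr_ge0 sqr_ge0.
have me := measurable_eval2 P.
have met : measurable_fun (setT : set (plane R)) (fun xi => eval2 P xi * t).
  by apply: measurable_funM => //; exact: measurable_cst.
have idot xi : cintegrable setT (fun x => packet f g xi0 x * cexpi (dot xi x)).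
  by apply: cintegrable_cexpi => //; exact: measurable_dotl.
pose J xi := cintegral setT (fun x => packet f g xi0 x * cexpi (dot xi x)).
have IE xi : I xi = real_complex R (F xi) * J xi.
  rewrite /J -cintegralZ//; congr (cintegral setT _); apply/funext => x.
  by rewrite mulrA.
pose Phi xi := c0 * (I xi * cexpi (eval2 P xi * t)).
have iPhi : cintegrable setT Phi by apply: cintegrableZ => //; exact: cintegrable_cexpi.
have -> : propagator P t (real_complex R \o F) (packet f g xi0) = cintegral setT Phi.
  rewrite /propagator /dist_inv_fourier /dist_of; congr (cintegral setT _); apply/funext => xi.
  by rewrite /Phi IE /J /inv_fourier -/c0 /=; ring.
rewrite -cintegralZ// -[leRHS]/(\int[leb2 R]_xi Re (cexpi (- alpha) * Phi xi)).
rewrite -RintegralZl//; apply: le_Rintegral => //.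
- exact: integrable_scale.
- exact: (cintegrableZ mT _ iPhi).1.
move=> xi _; rewrite /Phi IE.
have -> : cexpi (- alpha) * (c0 * (real_complex R (F xi) * J xi * cexpi (eval2 P xi * t))) =
    real_complex R ((2 * pi) ^- 2 * F xi) * (cexpi (eval2 P xi * t - alpha) * J xi).
  by rewrite rmorphM cexpiD /c0; ring.
rewrite Re_realM.
rewrite (_ : _ * F xi =
  (2 * pi) ^- 2 * F xi * (2^-1 * \int[leb2 R]_x (f x.1 * g x.2))); last by ring.
have [->|Fxi] := eqVneq (F xi) 0; first by rewrite !mulr0 !mul0r.
rewrite ler_wpM2l ?mulr_ge0//.
rewrite /J -cintegralZ// -[leRHS]/(\int[leb2 R]_x Re (cexpi (eval2 P xi * t - alpha) *
  (packet f g xi0 x * cexpi (dot xi x)))).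
rewrite -RintegralZl//; apply: le_Rintegral => //.
- exact: integrable_scale.
- exact: (cintegrableZ mT _ (idot xi)).1.
move=> x _; rewrite /packet.
have -> : cexpi (eval2 P xi * t - alpha) *
    (real_complex R (f x.1 * g x.2) * cexpi (- dot x xi0) * cexpi (dot xi x)) =
    real_complex R (f x.1 * g x.2) *
    cexpi (eval2 P xi * t + dot x (xi.1 - xi0.1, xi.2 - xi0.2) - alpha).
  have -> : eval2 P xi * t + dot x (xi.1 - xi0.1, xi.2 - xi0.2) - alpha =
      (eval2 P xi * t - alpha) + (- dot x xi0 + dot xi x) by rewrite /dot /=; ring.
  rewrite (cexpiD _ (- dot x xi0 + dot xi x)) (cexpiD (- dot x xi0)).
  by set e1 := cexpi _; set e2 := cexpi _; set e3 := cexpi _; ring.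
rewrite Re_realM Re_cexpi mulrC.
have [->|fg] := eqVneq (f x.1 * g x.2) 0; first by rewrite !mul0r.
by rewrite ler_wpM2l ?mulr_ge0// cos_ge_half// phase.
Qed.

Lemma sum_le_sup (J : nat) (a w : 'I_J -> R) (S : \bar R) :
  (0 <= S)%E -> (forall j, ((a j)%:E <= S)%E) -> (forall j, 0 <= w j) ->
  \sum_(j < J) w j <= 1 -> ((\sum_(j < J) a j * w j)%:E <= S)%E.
Proof.
case: S => [r| |]; [|by move=> *; rewrite leey|by []].
move=> r0 ar w0 w1; rewrite !lee_fin in r0 *; rewrite (le_trans (y := \sum_(j < J) r * w j))//.
  by apply: ler_sum => j _; rewrite ler_wpM2r// -lee_fin.
by rewrite -mulr_sumr ler_piMr.
Qed.

Lemma measurable_unit_ball : measurable (unit_ball R : set (plane R)).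
Proof.
have m1 : measurable_fun (setT : set (plane R)) (fst : R * R -> R) by exact: measurable_fst.
have m2 : measurable_fun (setT : set (plane R)) (snd : R * R -> R) by exact: measurable_snd.
have := @measurable_fun_ltr _ (plane R) R setT (@sqnorm R) (cst 1).
move=> /(_ _ (measurable_cst _)) H.
rewrite (_ : unit_ball R = setT `&` (fun x => sqnorm x < 1) @^-1` [set true]).
  by apply: H => //; apply: measurable_funD; apply: measurable_funM.
by rewrite setTI; apply/seteqP; split => x.
Qed.

(** At each point the weights h(x.1) g_j(x.2) sum to at most 1, so the sum of |u(t_j)| h g_j is at
    most the supremum over all times. Each summand has integral at least L, because the
    representative [u (t j)] may be tested against a packet supported inside the ball; the
    contributions of the J times therefore add up. *)
Lemma maximal_estimate_ge (P : mpoly.mpoly 2 R) (s C : R) (f : Defs.distribution R)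
    (fhat : R * R -> R[i]) (J : nat) (t alpha : 'I_J -> R) (h : R -> R) (g : 'I_J -> R -> R)
    (xi0 : R * R) (L r : R) :
  maximal_estimate P s C -> in_sobolev s f fhat -> (forall j, 0 < t j < 1) ->
  smooth1 h -> supported1 h -> (forall u, 0 <= h u) -> (forall u, h u <= 1) ->
  (forall j, smooth1 (g j)) -> (forall j, supported1 (g j)) -> (forall j u, 0 <= g j u) ->
  (forall u, \sum_(j < J) g j u <= 1) ->
  r < 1 -> (forall j x, r <= sqnorm x -> h x.1 * g j x.2 = 0) ->
  (forall j, L <= Re (cexpi (- alpha j) * propagator P (t j) fhat (packet h (g j) xi0))) ->
  ((J%:R * L)%:E <= C%:E * sobolev_norm s fhat)%E.
Proof.
move=> me fs t01 sh h1 h0 hle sg g1 g0 gle r1 hg0 HL.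
have [u [ru mS]] := me _ _ fs; apply: le_trans.
have mB := measurable_unit_ball.
pose w j x := cmod (u (t j) x) * (h x.1 * g j x.2).
have iw j : (leb2 R).-integrable (unit_ball R) (EFin \o w j) /\
    L <= \int[leb2 R]_(x in unit_ball R) w j x.
  have [iu rep] := ru _ (t01 j); have sp := schwartz_packet xi0 sh (sg j) h1 (g1 j).
  have cp x : cmod (packet h (g j) xi0 x) = h x.1 * g j x.2 by rewrite cmod_packet.
  have iup : cintegrable (unit_ball R) (fun x => u (t j) x * packet h (g j) xi0 x).
    have [mp1 mp2] := schwartz_cmeasurable sp.
    apply: (@cintegrableM _ _ mB _ _ 1) => //.
      by split; [exact: measurable_funTS mp1|exact: measurable_funTS mp2].
    move=> x _; rewrite cp mulr_ile1// (le_trans _ (gle x.2))//.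
    by rewrite (bigD1 j)//= lerDl sumr_ge0.
  have wE x : cmod (u (t j) x * packet h (g j) xi0 x) = w j x by rewrite cmodM cp.
  split.
    have := proj2 (cintegrableP mB (cintegrable_cmeasurable iup)) iup.
    by apply: eq_integrable => // x _; rewrite /comp wE.
  rewrite (le_trans (HL j))// rep//; last first.
    by exists r => // x rx; rewrite /packet hg0// mul0r.
  under [leRHS]eq_Rintegral do rewrite -wE.
  by apply: Re_cintegralZ_le => //; rewrite cmod_cexpi.
have H : ((J%:R * L)%:E <= \sum_(j < J) \int[leb2 R]_(x in unit_ball R) (w j x)%:E)%E.
  rewrite (eq_bigr (fun j => (\int[leb2 R]_(x in unit_ball R) w j x)%:E)) => [|j _].
    rewrite sumEFin lee_fin mulr_natl -[X in L *+ X]card_ord -sumr_const.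
    by apply: ler_sum => j _; exact: (iw j).2.
  by rewrite /Rintegral fineK//; exact: integrable_fin_num (iw j).1.
apply: (le_trans H); rewrite -ge0_integral_sum//; last 2 first.
- by move=> j; exact: measurable_int (iw j).1.
- by move=> j x _; rewrite lee_fin !mulr_ge0 ?cmod_ge0.
have cs x tt : 0 < tt < 1 -> ((cmod (u tt x))%:E <= sup_time u x)%E.
  by move=> tt01; apply: ereal_sup_ubound; exists tt => //=; rewrite in_itv.
have S0 x : (0 <= sup_time u x)%E.
  (* Any time in (0, 1) would do: the supremum runs over a nonempty set of nonnegative values. *)
  apply: (le_trans _ (cs x 2^-1 _)); first by rewrite lee_fin cmod_ge0.
  by rewrite invr_gt0 ltr0n invf_lt1// ltr1n.
apply: ge0_le_integral => //.
- by move=> x _; apply: sume_ge0 => j _; rewrite lee_fin !mulr_ge0 ?cmod_ge0.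
- by apply: emeasurable_sum => j; exact: measurable_int (iw j).1.
move=> x _; rewrite sumEFin; apply: sum_le_sup => // [j|j|]; first exact: cs.
  by rewrite mulr_ge0.
rewrite -mulr_sumr mulr_ile1//; exact: sumr_ge0.
Qed.

End lower_bound.

(** * Estimates on boxes *)

Section box_bounds.
Variable R : realType.
Let mu : {sigma_finite_measure set (measurableTypeR R) -> \bar R} := @lebesgue_measure R.
Local Notation ind u v := (\1_(`[u, v]%classic : set R) : R -> R).

Lemma indic_itvE (u v x : R) : ind u v x = if u <= x <= v then 1 else 0.
Proof.
rewrite indicE; case: ifPn => h; first by rewrite mem_set//= in_itv.
by rewrite memNset//= in_itv/=; apply/negP.
Qed.

Lemma integrable_le_box (f : R -> R) (M u v : R) :
  measurable_fun setT f -> (forall x, 0 <= f x) -> (forall x, f x <= M * ind u v x) ->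
  mu.-integrable setT (EFin \o f).
Proof.
move=> mf f0 fM; have := integrable_scale M (@integrable_indic_itv R u v true false).
apply: le_integrable => //; first exact/measurable_EFinP.
by move=> x _; rewrite lee_fin ger0_norm// (le_trans (fM x))// ler_norm.
Qed.

Lemma Rintegral_ge_box (f : R -> R) (m u v : R) : u <= v ->
  mu.-integrable setT (EFin \o f) -> (forall x, m * ind u v x <= f x) ->
  m * (v - u) <= \int[mu]_x f x.
Proof.
move=> uv fi mf; rewrite -Rintegral_indic_itv// -RintegralZl//; last first.
  exact: integrable_indic_itv.
apply: le_Rintegral => //; apply: integrable_scale; exact: integrable_indic_itv.
Qed.

Lemma tent_ge0 (a y : R) : 0 <= tent a y.
Proof. by rewrite /tent le_max lexx orbT. Qed.

Lemma tent_eq0 (a y : R) : a <= `|y| -> tent a y = 0.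
Proof. by move=> ay; rewrite /tent; apply/max_idPr; rewrite subr_le0. Qed.

Lemma measurable_tent (a p : R) : measurable_fun setT (fun x : R => tent a (x - p)).
Proof.
apply: measurable_maxr; last exact: measurable_cst.
apply: measurable_funB => //; apply: measurableT_comp => //.
exact: measurable_funB.
Qed.

Lemma tent_le_box (a p x : R) : 0 <= a -> tent a (x - p) <= a * ind (p - a) (p + a) x.
Proof.
move=> a0; rewrite indic_itvE -ler_distl; case: ifPn => h; rewrite ?mulr1 ?mulr0.
  by rewrite /tent ge_max a0 andbT gerBl.
by rewrite tent_eq0// ltW// ltNge.
Qed.

Lemma integrable_tent (a p : R) : 0 <= a ->
  mu.-integrable setT (EFin \o (fun x => tent a (x - p))).
Proof.
move=> a0; apply: (integrable_le_box (measurable_tent a p)) => x; first exact: tent_ge0.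
exact: tent_le_box.
Qed.

(** The tent is at least a/2 on the middle interval of length a. *)
Lemma Rintegral_tent_ge (a p : R) : 0 <= a ->
  a ^+ 2 / 2 <= \int[mu]_x tent a (x - p).
Proof.
move=> a0; have := @Rintegral_ge_box (fun x => tent a (x - p)) (a / 2) (p - a / 2) (p + a / 2).
have -> : a / 2 * (p + a / 2 - (p - a / 2)) = a ^+ 2 / 2 by field.
apply; [by lra|exact: integrable_tent|] => x.
rewrite indic_itvE -ler_distl; case: ifPn => h; rewrite ?mulr1 ?mulr0 ?tent_ge0//.
by rewrite /tent le_max; apply/orP; left; lra.
Qed.

Lemma measurable_bump (c d : R) : measurable_fun setT (fun x : R => bump (c * x + d)).
Proof.
apply: continuous_measurable_fun => x.
apply/differentiable_continuous/derivable1_diffP.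
by have [] := smooth1_is_derive 0 x (smooth1_bump c d).
Qed.

Lemma integrable_bump (c d : R) : 0 < c ->
  mu.-integrable setT (EFin \o (fun x => bump (c * x + d))).
Proof.
move=> c0; apply: (@integrable_le_box _ 1 (c^-1 * (- 1 - d)) (c^-1 * (1 - d))).
- exact: measurable_bump.
- by move=> x; exact: bump_ge0.
move=> x; rewrite indic_itvE ler_pdivrMl// ler_pdivlMl// mul1r.
rewrite lerBlDr lerBrDr -ler_norml; case: ifPn => h; first exact: bump_le1.
by rewrite bump_eq0// ltW// ltNge.
Qed.

Lemma Rintegral_bump_ge (c d : R) : 0 < c ->
  expR (- 4) / c <= \int[mu]_x bump (c * x + d).
Proof.
move=> c0; have := @Rintegral_ge_box (fun x => bump (c * x + d)) (expR (- 4))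
  (c^-1 * (- 2^-1 - d)) (c^-1 * (2^-1 - d)).
rewrite -mulrBr (_ : 2^-1 - d - (- 2^-1 - d) = 1); last by field.
rewrite mulr1; apply.
- by rewrite ler_pM2l ?invr_gt0//; lra.
- exact: integrable_bump.
move=> x; rewrite indic_itvE ler_pdivrMl// ler_pdivlMl//.
rewrite lerBlDr lerBrDr -ler_norml; case: ifPn => h; rewrite ?mulr1 ?mulr0 ?bump_ge0//.
exact: bump_ge.
Qed.

Lemma integrable_datum_hat (xi0 : R * R) (a b : R) : 0 <= a -> 0 <= b ->
  (leb2 R).-integrable setT (EFin \o datum_hat xi0 a b).
Proof.
move=> a0 b0; apply: integrable_scale.
exact: (integrable_tensor (m1 := mu) (m2 := mu) (integrable_tent _ a0) (integrable_tent _ b0)).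
Qed.

Lemma Rintegral_datum_hat_ge (xi0 : R * R) (a b : R) : 0 <= a -> 0 <= b ->
  fejer_mass R ^+ 2 * (a ^+ 2 / 2 * (b ^+ 2 / 2)) <= \int[leb2 R]_xi datum_hat xi0 a b xi.
Proof.
move=> a0 b0; have ia := integrable_tent xi0.1 a0; have ib := integrable_tent xi0.2 b0.
rewrite /datum_hat RintegralZl//; last exact: (integrable_tensor (m1 := mu) (m2 := mu) ia ib).
rewrite ler_wpM2l ?sqr_ge0//.
rewrite (Rintegral_tensor (m1 := mu) (m2 := mu) ia ib).
by rewrite ler_pM ?divr_ge0 ?sqr_ge0// Rintegral_tent_ge.
Qed.

Lemma datum_hat_ge0 (xi0 : R * R) (a b : R) xi : 0 <= datum_hat xi0 a b xi.
Proof. by rewrite /datum_hat mulr_ge0 ?sqr_ge0// mulr_ge0 ?tent_ge0. Qed.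

Lemma measurable_datum_hat (xi0 : R * R) (a b : R) :
  measurable_fun (setT : set (plane R)) (datum_hat xi0 a b).
Proof.
apply: measurable_funM; first exact: measurable_cst.
apply: measurable_funM.
  exact: (measurableT_comp (measurable_tent a xi0.1) (@measurable_fst _ _ _ _)).
exact: (measurableT_comp (measurable_tent b xi0.2) (@measurable_snd _ _ _ _)).
Qed.

Lemma datum_hat_le (xi0 : R * R) (a b : R) xi : 0 <= a -> 0 <= b ->
  datum_hat xi0 a b xi <= fejer_mass R ^+ 2 * (a * b) *
    (ind (xi0.1 - a) (xi0.1 + a) xi.1 * ind (xi0.2 - b) (xi0.2 + b) xi.2).
Proof.
move=> a0 b0; rewrite /datum_hat -mulrA ler_wpM2l ?sqr_ge0// mulrACA.
by rewrite ler_pM ?tent_ge0// tent_le_box.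
Qed.

(** The base 1 + |xi|^2 is at least 1, so raising s to sigma only increases the weight; sigma >= 0
    then makes the weight monotone in the base, so that W bounds it on the whole box. This also
    covers negative s. *)
Lemma sobolev_norm_datum_le (s sigma a b W : R) (xi0 : R * R) :
  0 <= a -> 0 <= b -> s <= sigma -> 0 <= sigma ->
  (forall xi : R * R, `|xi.1 - xi0.1| <= a -> `|xi.2 - xi0.2| <= b -> 1 + sqnorm xi <= W) ->
  (sobolev_norm s (real_complex R \o datum_hat xi0 a b) <=
   (Num.sqrt ((2 * pi) ^- 2 * (W `^ sigma * (fejer_mass R ^+ 2 * (a * b)) ^+ 2
                               * ((2 * a) * (2 * b)))))%:E)%E.
Proof.
move=> a0 b0 ssig sig0 HW; set M := W `^ sigma * _ ^+ 2.
have M0 : 0 <= M by rewrite mulr_ge0 ?powR_ge0// sqr_ge0.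
have c0 : 0 <= (2 * pi : R) ^- 2 by rewrite invr_ge0 sqr_ge0.
pose E1 := ind (xi0.1 - a) (xi0.1 + a); pose E2 := ind (xi0.2 - b) (xi0.2 + b).
have i1 : mu.-integrable setT (EFin \o E1) by exact: integrable_indic_itv.
have i2 : mu.-integrable setT (EFin \o E2) by exact: integrable_indic_itv.
have i12 := integrable_tensor (m1 := mu) (m2 := mu) i1 i2.
have sq0 (x : R * R) : 0 <= sqnorm x by rewrite /sqnorm /dot addr_ge0// -expr2 sqr_ge0.
have H : (\int[leb2 R]_xi ((1 + sqnorm xi) `^ s *
    cmod ((real_complex R \o datum_hat xi0 a b) xi) ^+ 2)%:E <= (M * ((2 * a) * (2 * b)))%:E)%E.
  have -> : M * (2 * a * (2 * b)) = \int[leb2 R]_x (M * (E1 x.1 * E2 x.2)).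
    rewrite RintegralZl// (Rintegral_tensor (m1 := mu) (m2 := mu) i1 i2).
    by rewrite !Rintegral_indic_itv; [congr (_ * (_ * _)); ring|lra..].
  rewrite /Rintegral fineK; last first.
    by apply: integrable_fin_num => //; exact: (integrable_scale M i12).
  apply: ge0_le_integral => //.
  - by move=> x _; rewrite lee_fin mulr_ge0 ?powR_ge0// sqr_ge0.
  - apply/measurable_EFinP; apply: measurable_funM.
      apply: (@measurableT_comp _ _ _ _ _ _ (@powR R ^~ s)); first exact: measurable_powR.
      have m1 : measurable_fun (setT : set (plane R)) (fst : R * R -> R) by exact: measurable_fst.
      have m2 : measurable_fun (setT : set (plane R)) (snd : R * R -> R) by exact: measurable_snd.
      apply: measurable_funD; first exact: measurable_cst.
      by apply: measurable_funD; apply: measurable_funM.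
    apply: measurable_funX; apply: measurable_cmod; split => /=; last exact: measurable_cst.
    exact: measurable_datum_hat.
  - exact: measurable_int (integrable_scale M i12).
  move=> x _; rewrite lee_fin cmod_real ger0_norm ?datum_hat_ge0//.
  have hle := datum_hat_le xi0 x a0 b0; rewrite -/E1 -/E2 in hle.
  (* Off the box W gives no control of the weight, but there the datum vanishes. *)
  have [z|z] := eqVneq (datum_hat xi0 a b x) 0.
    by rewrite z expr0n/= mulr0 (mulr_ge0 M0)// (@mulr_ge0 _ (E1 _)).
  have x1 : `|x.1 - xi0.1| <= a.
    by rewrite leNgt; apply: contra z => h; rewrite /datum_hat tent_eq0 ?(ltW h)// mul0r mulr0.
  have x2 : `|x.2 - xi0.2| <= b.
    by rewrite leNgt; apply: contra z => h; rewrite /datum_hat (tent_eq0 (ltW h)) !mulr0.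
  have e12 : E1 x.1 * E2 x.2 = 1.
    by rewrite /E1 /E2 !indic_itvE -!ler_distl x1 x2 mulr1.
  rewrite e12 mulr1 in hle *.
  have h1 : datum_hat xi0 a b x ^+ 2 <= (fejer_mass R ^+ 2 * (a * b)) ^+ 2.
    have d0 := datum_hat_ge0 xi0 a b x.
    by rewrite lerXn2r// nnegrE// (le_trans d0).
  have h2 : (1 + sqnorm x) `^ s <= W `^ sigma.
    have le1 : 1 <= 1 + sqnorm x by rewrite lerDl.
    rewrite (le_trans (ler_powR le1 ssig))//; have hW := HW x x1 x2.
    have s0 : 0 <= 1 + sqnorm x by rewrite addr_ge0.
    by apply: ge0_ler_powR => //; rewrite nnegrE// (le_trans s0).
  by rewrite [leRHS]mulr1 /M; apply: ler_pM; rewrite ?powR_ge0 ?sqr_ge0.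
rewrite /sobolev_norm -powR12_sqrt; last by rewrite (mulr_ge0 c0)// (mulr_ge0 M0)// !mulr_ge0.
rewrite -poweR_EFin; apply: gt0_ler_poweR; rewrite ?invr_ge0//.
- rewrite in_itv/= leey andbT mule_ge0 ?lee_fin//; apply: integral_ge0 => x _.
  by rewrite lee_fin mulr_ge0 ?powR_ge0// sqr_ge0.
- by rewrite in_itv/= leey andbT lee_fin (mulr_ge0 c0)// (mulr_ge0 M0)// !mulr_ge0.
- by rewrite EFinM lee_wpmul2l ?lee_fin.
Qed.

End box_bounds.

(** * Phase and parameters *)

Section final.
Variable R : realType.

(** Relative to the phase at the centre, what remains is t D + x.1 r + (x.2 + t K q1) s, where D is
    the nonlinear error, (r, s) the frequency shift and K = N^(k-1). The three terms are at most (2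
    C / |q1|) eps, eps / 2 and eps / 4, and eps is chosen to make the total at most 1. *)
Lemma phase_le (k : nat) (p : R * R -> R) (q1 m C eps n t : R) (x xi : R * R) :
  (0 < k)%N -> q1 != 0 -> 0 <= C -> 0 < eps -> eps <= 1 ->
  eps * (2 * C / `|q1| + 1) = 1 -> 1 <= n ->
  (forall u v, `|u| <= 1 -> `|v| <= 1 ->
    `|p (n ^+ 3 * (1 + u), n ^+ 3 * (m + v)) - p (n ^+ 3, n ^+ 3 * m)
       - (n ^+ 3) ^+ k * q1 * v| <=
    C * ((n ^+ 3) ^+ k * (`|u| + `|v| ^+ 3) + (n ^+ 3) ^+ k.-1 * (`|u| + `|v|))) ->
  `|xi.1 - n ^+ 3| <= eps -> `|xi.2 - n ^+ 3 * m| <= eps * n ^+ 2 ->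
  0 <= t -> t * ((n ^+ 3) ^+ k.-1 * `|q1|) <= 2^-1 ->
  `|x.1| <= 2^-1 -> `|x.2 + t * ((n ^+ 3) ^+ k.-1 * q1)| <= (4 * n ^+ 2)^-1 ->
  `|p xi * t + dot x (xi.1 - n ^+ 3, xi.2 - n ^+ 3 * m) - t * p (n ^+ 3, n ^+ 3 * m)| <= 1.
Proof.
move=> k0 q10 C0 eps0 eps1 epsE n1 hp hr hs t0 tq hx1 hx2.
have n0 : 0 < n by rewrite (lt_le_trans _ n1).
pose N := n ^+ 3; have N0 : 0 < N by rewrite exprn_gt0.
have N1 : 1 <= N by rewrite exprn_ege1.
pose r := xi.1 - N; pose s := xi.2 - N * m; pose u := r / N; pose v := s / N.
have Nu : N * u = r by rewrite mulrC divfK ?gt_eqF.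
have Nv : N * v = s by rewrite mulrC divfK ?gt_eqF.
have nrmu : `|u| = `|r| / N by rewrite normrM normfV (gtr0_norm N0).
have nrmv : `|v| = `|s| / N by rewrite normrM normfV (gtr0_norm N0).
have hu : `|u| <= eps.
  by rewrite nrmu ler_pdivrMr// (le_trans hr)// ler_peMr// ltW.
have hv : `|v| <= eps.
  rewrite nrmv ler_pdivrMr// (le_trans hs)// ler_wpM2l ?(ltW eps0)//.
  by rewrite /N ler_weXn2l.
(* The place where the box height n^2 is critical: N |v|^3 = |s|^3 / N^2, and (n^2)^3 = N^2. *)
have hv3 : N * `|v| ^+ 3 <= eps.
  have -> : N * `|v| ^+ 3 = `|s| ^+ 3 / N ^+ 2.
    by rewrite nrmv; field; rewrite gt_eqF.
  rewrite ler_pdivrMr ?exprn_gt0// (le_trans (y := (eps * n ^+ 2) ^+ 3))//.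
    by rewrite lerXn2r ?nnegrE// mulr_ge0 ?exprn_ge0 ?ltW.
  rewrite exprMn /N -!exprM ler_wpM2r ?exprn_ge0 ?(ltW n0)//.
  by rewrite -[leRHS]expr1 ler_wiXn2l// ltW.
have := hp u v (le_trans hu eps1) (le_trans hv eps1).
have -> : (n ^+ 3 * (1 + u), n ^+ 3 * (m + v)) = xi.
  rewrite -/N !mulrDr mulr1 Nu Nv /r /s; case: (xi) => a b /=.
  by congr (_, _); ring.
rewrite -/N; set D := p xi - p (N, N * m) - _ => hD.
have NkE : N ^+ k = N ^+ k.-1 * N by rewrite -exprSr prednK.
set K := N ^+ k.-1 in hD tq hx2 NkE *; have K0 : 0 <= K by rewrite exprn_ge0 ?ltW.
have -> : p xi * t + dot x (xi.1 - N, xi.2 - N * m) - t * p (N, N * m) =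
    t * D + x.1 * r + (x.2 + t * (K * q1)) * s.
  by rewrite /D NkE /dot /= -/r -/s -Nv; ring.
have htD : `|t * D| <= 2 * C / `|q1| * eps.
  (* Each of N |u|, N |v|^3, |u| and |v| is at most eps, hence the 4. *)
  have hD' : `|D| <= C * (K * (4 * eps)).
    rewrite (le_trans hD)// ler_wpM2l// NkE -mulrA -mulrDr ler_wpM2l//.
    have : N * `|u| <= eps by rewrite -(gtr0_norm N0) -normrM Nu.
    by rewrite mulrDr; lra.
  rewrite normrM (ger0_norm t0) (le_trans (ler_wpM2l t0 hD'))//.
  have q0 : 0 < `|q1| by rewrite normr_gt0.
  have tK : t * K <= 2^-1 / `|q1| by rewrite ler_pdivlMr// -mulrA.
  have -> : t * (C * (K * (4 * eps))) = (t * K) * (C * 4 * eps) by ring.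
  have -> : 2 * C / `|q1| * eps = (2^-1 / `|q1|) * (C * 4 * eps) by field; rewrite gt_eqF.
  by rewrite ler_wpM2r// !mulr_ge0// ltW.
have h1 : `|x.1 * r| <= 2^-1 * eps by rewrite normrM ler_pM.
have h2 : `|(x.2 + t * (K * q1)) * s| <= 4^-1 * eps.
  rewrite normrM (le_trans (ler_pM _ _ hx2 hs))//.
  have -> : (4 * n ^+ 2)^-1 * (eps * n ^+ 2) = 4^-1 * eps by field; rewrite gt_eqF.
  exact: lexx.
rewrite (le_trans (ler_normD _ _))// (le_trans (lerD (ler_normD _ _) (lexx _)))//.
by rewrite mulrDr mulr1 in epsE; lra.
Qed.

(** The centres are at mutual distance at least 2 and each bump vanishes at distance 1 from its
    centre, so at most one term is nonzero at u. *)
Lemma bump_partition (J : nat) (sg u : R) : `|sg| = 1 ->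
  \sum_(j < J) bump (u + (2 * j + 1)%:R * sg) <= 1.
Proof.
move=> sg1.
have [[j hj]|none] := pselect (exists j : 'I_J, bump (u + (2 * j + 1)%:R * sg) != 0).
  rewrite (bigD1 j)//= big1 ?addr0 ?bump_le1// => i ij; apply/eqP/negPn/negP => hi.
  have b1 (l : 'I_J) : bump (u + (2 * l + 1)%:R * sg) != 0 -> `|u + (2 * l + 1)%:R * sg| < 1.
    by move=> hl; rewrite ltNge; apply: contra hl => /bump_eq0 ->.
  have := b1 _ hi; have := b1 _ hj => h1 h2.
  have : `|(u + (2 * i + 1)%:R * sg) - (u + (2 * j + 1)%:R * sg)| < 2.
    by rewrite (le_lt_trans (ler_normB _ _))//; lra.
  rewrite (_ : _ - _ = (((2 * i)%:Z - (2 * j)%:Z)%:~R) * sg); last first.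
    by rewrite intrB !natrD -!pmulrn; ring.
  rewrite normrM sg1 mulr1 -intr_norm -[2]/(2%:Z%:~R) ltr_int.
  move: ij; rewrite -val_eqE/=; lia.
rewrite big1 => [//|j _]; apply/eqP/negPn/negP => hj; apply: none; by exists j.
Qed.

(** The squared estimate compares n^8 with n^(6 + 6 sigma); after division by n^6 the left side wins
    for large n exactly because 6 sigma < 2. *)
Lemma powR_growth (sigma c : R) (n0 : nat) : sigma < 3^-1 ->
  exists n : nat, [/\ (n0 <= n)%N, (0 < n)%N & c * n%:R `^ (6 * sigma) < n%:R ^+ 2].
Proof.
move=> s3; pose tau := 2 - 6 * sigma; have tau0 : 0 < tau by rewrite /tau; lra.
pose A := (`|c| + 1) `^ tau^-1.
pose n := (maxn n0 (Num.truncn A)).+1; exists n; split => //.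
  by rewrite /n (leq_trans (leq_maxl _ (Num.truncn A))).
have n1 : 0 < n%:R :> R by rewrite ltr0n.
have An : A <= n%:R.
  by rewrite ltW// (lt_le_trans (truncnS_gt A))// ler_nat ltnS leq_maxr.
have -> : n%:R ^+ 2 = n%:R `^ tau * n%:R `^ (6 * sigma) :> R.
  rewrite -powRD; last by rewrite (gt_eqF n1) implybT.
  by rewrite /tau subrK powR_mulrn// ltW.
rewrite ltr_pM2r ?powR_gt0//.
have : A `^ tau <= n%:R `^ tau.
  by apply: ge0_ler_powR; rewrite ?nnegrE ?powR_ge0// ltW.
rewrite /A -powRrM mulVf ?gt_eqF// powRr1 ?addr_ge0//; apply: lt_le_trans.
by rewrite (le_lt_trans (ler_norm c))// ltrDl.
Qed.

End final.

(** * The estimate for the datum, and the contradiction for large n *)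

Section necessity.
Variable R : realType.
Let mu : {sigma_finite_measure set (measurableTypeR R) -> \bar R} := @lebesgue_measure R.

Lemma bump_neq0 (x : R) : bump x != 0 -> `|x| < 1.
Proof. by move=> h; rewrite ltNge; apply: contra h => /bump_eq0 ->. Qed.

(** The left side is the number n^2 of times, multiplied by the factor of [propagator_packet_ge], by
    lower bounds for the integrals of the two test bumps, of widths of order 1 and n^(-2), and by
    one for the integral of the transform. *)
Lemma maximal_estimate_datum (k : nat) (P : mpoly.mpoly 2 R) (q1 m C s B eps : R) (n : nat) :
  (0 < k)%N -> q1 != 0 -> 0 <= C -> 0 < eps -> eps <= 1 ->
  eps * (2 * C / `|q1| + 1) = 1 -> (0 < n)%N ->
  1 <= (n%:R ^+ 3) ^+ k.-1 * `|q1| ->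
  (forall u v, `|u| <= 1 -> `|v| <= 1 ->
    `|eval2 P (n%:R ^+ 3 * (1 + u), n%:R ^+ 3 * (m + v)) - eval2 P (n%:R ^+ 3, n%:R ^+ 3 * m)
       - (n%:R ^+ 3) ^+ k * q1 * v| <=
    C * ((n%:R ^+ 3) ^+ k * (`|u| + `|v| ^+ 3) + (n%:R ^+ 3) ^+ k.-1 * (`|u| + `|v|))) ->
  let xi0 := (n%:R ^+ 3, n%:R ^+ 3 * m) in
  let b := eps * n%:R ^+ 2 in
  let fhat := real_complex R \o datum_hat xi0 eps b in
  maximal_estimate P s B -> (sobolev_norm s fhat < +oo)%E ->
  (((n ^ 2)%:R * ((2 * pi) ^- 2 / 2 * (expR (- 4) / 2 * (expR (- 4) / (4 * n%:R ^+ 2)))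
      * (fejer_mass R ^+ 2 * (eps ^+ 2 / 2 * (b ^+ 2 / 2)))))%:E
    <= B%:E * sobolev_norm s fhat)%E.
Proof.
move=> k0 q10 C0 eps0 eps1 epsE n0 Kq hP xi0 b fhat me fin.
have n1 : 1 <= n%:R :> R by rewrite ler1n.
have nn0 : 0 < n%:R :> R by rewrite ltr0n.
pose K : R := (n%:R ^+ 3) ^+ k.-1 * `|q1|; have K0 : 0 < K by exact: lt_le_trans Kq.
have b0 : 0 <= b by rewrite mulr_ge0 ?exprn_ge0 ?ltW.
pose sg := q1 / `|q1|.
have q1n0 : `|q1| != 0 by rewrite normr_eq0.
have sg1 : `|sg| = 1 by rewrite normrM normfV normr_id divff.
(* Strip j has centre x.2 = - a j * sg and half-width 1 / (4 n^2). The n^2 strips tile a segment of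
   length 1/2 starting at the origin, on the side towards which the datum moves, and so stay inside
   the ball. *)
pose a (j : 'I_(n ^ 2)) : R := (2 * j + 1)%:R / (4 * n%:R ^+ 2).
have n20 : 0 < 4 * n%:R ^+ 2 :> R by rewrite mulr_gt0// exprn_gt0.
have jle (j : 'I_(n ^ 2)) : (2 * j + 1)%:R <= 2 * n%:R ^+ 2 - 1 :> R.
  rewrite lerBrDr natr1 -natrX -natrM ler_nat.
  have -> : (2 * j + 1).+1 = (2 * j.+1)%N by rewrite -addn1 -addnA mulnS addnC.
  by rewrite leq_mul2l ltn_ord.
have a2 j : 0 < a j <= 2^-1.
  apply/andP; split; first by rewrite divr_gt0// ltr0n addn1.
  by rewrite ler_pdivrMr// (le_trans (jle j))//; lra.
(* The strip has reached the support of [g j] at time [t j]. *)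
pose t j := a j / K; have tK j : t j * K = a j by rewrite /t divfK ?gt_eqF.
have t01 j : 0 < t j < 1.
  have /andP[a0 a1] := a2 j; rewrite divr_gt0//= ltr_pdivrMr// mul1r.
  by rewrite (le_lt_trans a1)// (lt_le_trans _ Kq)// invf_lt1// ltr1n.
pose h : R -> R := fun u => bump (2 * u + 0).
pose g (j : 'I_(n ^ 2)) : R -> R := fun u => bump (4 * n%:R ^+ 2 * u + (2 * j + 1)%:R * sg).
have h2 u : h u != 0 -> `|u| < 2^-1.
  by rewrite /h addr0 => /bump_neq0; rewrite normrM ger0_norm// mulrC -ltr_pdivlMr// mul1r.
have g2 j u : g j u != 0 -> `|u| < 2^-1.
  move=> /bump_neq0 hu.
  have : `|4 * n%:R ^+ 2 * u| < 2 * n%:R ^+ 2.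
    rewrite -(addrK ((2 * j + 1)%:R * sg) (_ * u)) (le_lt_trans (ler_normB _ _))//.
    rewrite [X in _ + X]normrM sg1 mulr1 [X in _ + X]ger0_norm//.
    by have := jle j; lra.
  rewrite normrM (gtr0_norm n20) mulrC -ltr_pdivlMr//.
  by rewrite (_ : 2 * _ / _ = 2^-1)//; field; rewrite gt_eqF.
have small (f : R -> R) : (forall u, f u != 0 -> `|u| < 2^-1) -> supported1 f.
  move=> hf u u1; apply/eqP/negPn/negP => /hf hu.
  by have := lt_trans u1 hu; rewrite ltNge invf_le1// ler1n.
have fhat_le xi : cmod (fhat xi) <= fejer_mass R ^+ 2 * (eps * b).
  have ind01 (u v x : R) : 0 <= (\1_(`[u, v]%classic : set R) x : R) <= 1.
    by rewrite indic_itvE; case: ifP; rewrite ?lexx ler01.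
  rewrite cmod_real (ger0_norm (datum_hat_ge0 _ _ _ _)).
  apply: le_trans (datum_hat_le xi0 xi (ltW eps0) b0) _.
  apply: ler_piMr; first by rewrite mulr_ge0 ?sqr_ge0// mulr_ge0// ltW.
  have /andP[i0 i1] := ind01 (xi0.1 - eps) (xi0.1 + eps) xi.1.
  have /andP[j0 j1] := ind01 (xi0.2 - b) (xi0.2 + b) xi.2.
  exact: mulr_ile1.
have sob : in_sobolev s (dist_of (datum xi0 eps b)) fhat.
  apply: in_sobolev_dist_of fhat_le _ fin.
  - exact: cintegrable_datum.
  - by split => /=; [exact: measurable_datum_hat|exact: measurable_cst].
  - by apply: fourier_datum => //; exact: ltW.
pose alpha j := t j * eval2 P xi0.
apply: (maximal_estimate_ge (t := t) (alpha := alpha) (h := h) (g := g) (xi0 := xi0)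
  (r := 2^-1) me sob t01) => //.
- exact: smooth1_bump.
- exact: small.
- by move=> u; exact: bump_ge0.
- by move=> u; exact: bump_le1.
- by move=> j; exact: smooth1_bump.
- by move=> j; apply: small; exact: g2.
- by move=> j u; exact: bump_ge0.
- by move=> u; exact: bump_partition.
- by rewrite invf_lt1// ltr1n.
- move=> j x hx; apply/eqP; rewrite mulf_eq0; apply/negPn/negP; rewrite negb_or => /andP[hh hg].
  have sq (u : R) : `|u| < 2^-1 -> u ^+ 2 < 4^-1.
    move=> u2; rewrite -real_normK ?num_real// (_ : 4^-1 = 2^-1 ^+ 2); last by field.
    by rewrite ltrXn2r.
  have := sq _ (h2 _ hh); have := sq _ (g2 _ _ hg).
  by move: hx; rewrite /sqnorm /dot -!expr2 => ? ? ?; lra.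
move=> j.
have ih : mu.-integrable setT (EFin \o h) by exact: integrable_bump.
have ig : mu.-integrable setT (EFin \o g j) by exact: integrable_bump.
apply: le_trans (propagator_packet_ge (t := t j) (alpha := alpha j) (f := h) (g := g j)
  (xi0 := xi0) (integrable_datum_hat xi0 (ltW eps0) b0) (datum_hat_ge0 xi0 eps b) _ _ _ _ _ _ _).
- have c0 : 0 <= (2 * pi : R) ^- 2 / 2 by rewrite divr_ge0 ?invr_ge0 ?sqr_ge0.
  have e0 : 0 <= expR (- 4) / 2 :> R by rewrite divr_ge0 ?expR_ge0.
  have e1 : 0 <= expR (- 4) / (4 * n%:R ^+ 2) :> R by rewrite divr_ge0 ?expR_ge0 ?ltW.
  apply: ler_pM.
  + by rewrite (mulr_ge0 c0)// (mulr_ge0 e0).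
  + by rewrite mulr_ge0 ?sqr_ge0// mulr_ge0 ?divr_ge0 ?sqr_ge0.
  + apply: ler_wpM2l => //.
    rewrite (Rintegral_tensor (m1 := mu) (m2 := mu) ih ig).
    by apply: ler_pM => //; exact: Rintegral_bump_ge.
  + by apply: Rintegral_datum_hat_ge => //; exact: ltW.
- exact: smooth1_bump.
- exact: smooth1_bump.
- exact: small.
- by apply: small; exact: g2.
- by move=> u; exact: bump_ge0.
- by move=> u; exact: bump_ge0.
move=> xi x Fxi; rewrite mulf_eq0 negb_or => /andP[hx1 hx2].
have /andP[t0 t1] := t01 j; have /andP[a0 a1] := a2 j.
apply: (@phase_le R k (eval2 P) q1 m C eps n%:R) => //.
- rewrite leNgt; apply: contra Fxi => hxi.
  by rewrite /datum_hat tent_eq0 ?(ltW hxi)// mul0r mulr0.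
- rewrite leNgt; apply: contra Fxi => hxi.
  by rewrite /datum_hat (tent_eq0 (ltW hxi)) !mulr0.
- exact: ltW.
- by rewrite -/K tK.
- exact/ltW/h2.
- have -> : t j * ((n%:R ^+ 3) ^+ k.-1 * q1) = a j * sg.
    rewrite -tK /K /sg; field; exact: q1n0.
  have -> : x.2 + a j * sg = (4 * n%:R ^+ 2 * x.2 + (2 * j + 1)%:R * sg) / (4 * n%:R ^+ 2).
    by rewrite /a; field; rewrite gt_eqF.
  rewrite normrM normfV (gtr0_norm n20) ler_piMl ?invr_ge0 ?(ltW n20)//.
  exact/ltW/bump_neq0.
Qed.

Lemma maximal_estimate_necessary (k : nat) (P : mpoly.mpoly 2 R) (c : 'I_k.+1 -> R) (s B : R) :
  (2 <= k)%N -> has_degree P k -> inflected c -> pihomog mdeg k P = binary_form c ->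
  maximal_estimate P s B -> 3^-1 <= s.
Proof.
move=> k2 Pk [m m2 m1] Pc me; rewrite leNgt; apply/negP => s3.
have k0 : (0 < k)%N by lia.
have k31 : (1 <= 3 * k.-1)%N by lia.
have [C C0 hC] := polynomial_expansion k0 Pk Pc m2.
set q1 := (slice c)^`().[m] in m1 hC.
have q0 : 0 < `|q1| by rewrite normr_gt0.
pose D := 2 * C / `|q1| + 1.
have D1 : 1 <= D by rewrite lerDr divr_ge0 ?mulr_ge0// ltW.
have D0 : 0 < D by rewrite (lt_le_trans _ D1).
pose eps := D^-1; have eps0 : 0 < eps by rewrite invr_gt0.
have eps1 : eps <= 1 by rewrite invf_le1.
have epsE : eps * D = 1 by rewrite mulVf ?gt_eqF.
(* Negative s is absorbed here; the assumption s < 1/3 passes to sigma. *)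
pose sigma := Num.max s 0.
have sig0 : 0 <= sigma by rewrite le_max lexx orbT.
have ssig : s <= sigma by rewrite le_max lexx.
have sig3 : sigma < 3^-1 by rewrite gt_max s3 invr_gt0 ltr0n.
pose kap := fejer_mass R; have kap0 : 0 < kap by exact: fejer_mass_gt0.
(* On the box |xi.1| <= 2 N and |xi.2| <= (|m| + 1) N, and the remaining 1 is at most N^2. *)
pose w0 : R := 5 + (`|m| + 1) ^+ 2.
have w00 : 0 <= w0 by rewrite addr_ge0// sqr_ge0.
(* The constants collect everything independent of n: the lower bound becomes c1 n^4 and the squared
   norm bound c2 w0^sigma n^6 n^(6 sigma); c3 is the resulting ratio. *)
pose c1 : R := (2 * pi) ^- 2 / 2 * (expR (- 4) / 2 * (expR (- 4) / 4))
  * (kap ^+ 2 * (eps ^+ 4 / 4)).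
have pi2 : 0 < (2 * pi : R) ^- 2 by rewrite invr_gt0 exprn_gt0// mulr_gt0// pi_gt0.
have c10 : 0 < c1.
  by rewrite /c1 !(mulr_gt0, divr_gt0) ?expR_gt0 ?exprn_gt0.
pose c2 : R := (2 * pi) ^- 2 * kap ^+ 4 * 4 * eps ^+ 6.
pose c3 := B ^+ 2 * (c2 * w0 `^ sigma) / c1 ^+ 2.
(* The threshold makes n at least 1/|q1|, hence N^(k-1) |q1| >= 1, so that the strip crosses its
   segment within the time interval (0, 1). *)
have [n [nn0 n0 hn]] := powR_growth c3 (Num.truncn `|q1|^-1).+1 sig3.
have n1 : 1 <= n%:R :> R by rewrite ler1n.
have np : 0 < n%:R :> R by rewrite ltr0n.
pose N : R := n%:R ^+ 3; have N1 : 1 <= N by rewrite exprn_ege1.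
have N0 : 0 < N by rewrite (lt_le_trans _ N1).
have Kq : 1 <= N ^+ k.-1 * `|q1|.
  rewrite -ler_pdivrMr// div1r (le_trans (y := n%:R))//.
    by rewrite ltW// (lt_le_trans (truncnS_gt _))// ler_nat.
  by rewrite /N -exprM -[leLHS]expr1 ler_weXn2l.
pose b := eps * n%:R ^+ 2; have b0 : 0 <= b by rewrite mulr_ge0 ?exprn_ge0 ?ltW.
have bN : b <= N.
  rewrite /b /N (le_trans (ler_piMl _ eps1)) ?exprn_ge0 ?(ltW np)//.
  by rewrite ler_weXn2l.
pose xi0 := (N, N * m); pose fhat := real_complex R \o datum_hat xi0 eps b.
have HW (xi : R * R) : `|xi.1 - xi0.1| <= eps -> `|xi.2 - xi0.2| <= b ->
    1 + sqnorm xi <= w0 * n%:R ^+ 6.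
  move=> h1 h2.
  have x1 : `|xi.1| <= 2 * N.
    rewrite -(subrK N xi.1) (le_trans (ler_normD _ _))// (gtr0_norm N0).
    by have : `|xi.1 - N| <= 1 := le_trans h1 eps1; lra.
  have x2 : `|xi.2| <= (`|m| + 1) * N.
    rewrite -(subrK (N * m) xi.2) (le_trans (ler_normD _ _))// normrM (gtr0_norm N0).
    by have : `|xi.2 - N * m| <= N := le_trans h2 bN; lra.
  have y1 : xi.1 ^+ 2 <= (2 * N) ^+ 2.
    by rewrite -real_normK ?num_real// lerXn2r ?nnegrE// mulr_ge0// ltW.
  have y2 : xi.2 ^+ 2 <= ((`|m| + 1) * N) ^+ 2.
    by rewrite -real_normK ?num_real// lerXn2r ?nnegrE// mulr_ge0 ?addr_ge0// ltW.
  have N21 : 1 <= N ^+ 2 by rewrite exprn_ege1.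
  rewrite /sqnorm /dot -!expr2 (_ : n%:R ^+ 6 = N ^+ 2); last by rewrite /N -exprM.
  rewrite (exprMn _ _ N) in y1; rewrite (exprMn _ _ N) in y2; rewrite /w0 mulrDl.
  by clear -y1 y2 N21; lra.
have norm_le := sobolev_norm_datum_le (ltW eps0) b0 ssig sig0 HW.
set Q := (2 * pi) ^- 2 * _ in norm_le.
have := @maximal_estimate_datum k P q1 m C s B eps n k0 m1 C0 eps0 eps1 epsE n0 Kq.
have hE u v : `|u| <= 1 -> `|v| <= 1 ->
    `|eval2 P (N * (1 + u), N * (m + v)) - eval2 P (N, N * m) - N ^+ k * q1 * v| <=
    C * (N ^+ k * (`|u| + `|v| ^+ 3) + N ^+ k.-1 * (`|u| + `|v|)).
  by move=> u1 v1; apply: (hC (N, (u, v))).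
move=> /(_ hE me); rewrite -/N -/xi0 -/b -/fhat => /(_ (le_lt_trans norm_le (ltry _))).
set L := _ * (_ * _) => HL.
have L0 : 0 <= L.
  by rewrite /L !(mulr_ge0, divr_ge0) ?expR_ge0 ?exprn_ge0 ?(ltW eps0) ?(ltW kap0) ?(ltW np)// ltW.
have LB : L <= `|B| * Num.sqrt Q.
  rewrite -lee_fin (le_trans HL)// EFinM.
  have s0 : (0 <= sobolev_norm s fhat)%E by exact: poweR_ge0.
  rewrite (le_trans (lee_wpmul2r s0 (_ : (B%:E <= `|B|%:E)%E)))//.
    by rewrite lee_fin ler_norm.
  by rewrite lee_wpmul2l// lee_fin.
have Q0 : 0 <= Q.
  rewrite /Q (mulr_ge0 (ltW pi2))// mulr_ge0//.
    by rewrite mulr_ge0 ?powR_ge0 ?sqr_ge0.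
  by rewrite !mulr_ge0// ltW.
have : L ^+ 2 <= B ^+ 2 * Q.
  rewrite -[X in X * Q]real_normK ?num_real// -(sqr_sqrtr Q0) -exprMn.
  by rewrite lerXn2r ?nnegrE// mulr_ge0// sqrtr_ge0.
have nsE : (n%:R ^+ 6) `^ sigma = n%:R `^ (6 * sigma) :> R.
  by rewrite -(powR_mulrn 6 (ltW np)) -powRrM.
have -> : Q = c2 * w0 `^ sigma * n%:R ^+ 6 * n%:R `^ (6 * sigma).
  rewrite /Q powRM ?exprn_ge0 ?(ltW np)// nsE /c2 /b -/kap.
  by move: (2 * pi : R) => X; set Y := w0 `^ sigma; set Z := n%:R `^ _; ring.
have -> : L = c1 * n%:R ^+ 4.
  have nn : n%:R != 0 :> R by rewrite gt_eqF.
  rewrite /L /c1 /b -/kap natrX; move: (expR (- 4)) ((2 * pi) ^- 2) => E Z.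
  by field.
move=> H; move: hn; rewrite ltNge => /negP; apply.
rewrite /c3 mulrAC ler_pdivlMr ?exprn_gt0//.
have n6 : 0 < n%:R ^+ 6 :> R by rewrite exprn_gt0.
rewrite -(ler_pM2r n6); apply: le_trans (le_trans H _);
  by rewrite le_eqVlt; apply/orP; left; apply/eqP; ring.
Qed.

End necessity.

Theorem corollary1p5 (R : realType) (k : nat) (hodd : odd k) (hk : (3 <= k)%N) :
  exists G : set ('I_k.+1 -> R),
    zariski_dense G /\
    forall P : mpoly.mpoly 2 R,
      has_degree P k -> leading_form_in P G ->
      forall s : R,
        (exists C : R, maximal_estimate P s C) ->
        3^-1 <= s.
Proof.
exists (@inflected R k); split; first exact: zariski_dense_inflected.
move=> P Pk [c Gc Pc] s [C me].
by apply: maximal_estimate_necessary Pk Gc Pc me; exact: ltnW.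
Qed.
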